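(* Let $0\le\gamma<1$ and let $f=h+\overline{g}$ be harmonic in $\Omega_\gamma$, where $h,g$ are analytic in $\Omega_\gamma$ with $h(z)=\sum_{n=0}^\infty a_nz^n$, $g(z)=\sum_{n=0}^\infty b_nz^n$ for $z\in\mathbb{D}$, and suppose $|h(z)|+|g(z)|\le1$ for all $z\in\Omega_\gamma$. Then $$\sqrt{|a_0|^2+|b_0|^2}+\sum_{n=1}^\infty\sqrt{|a_n|^2+|b_n|^2}\,r^n\le1\quad\text{for } |z|=r\le r_0:=\frac{1+\gamma}{3+\gamma}.$$
   Context: $\mathbb{D}$ is the open unit disk. For $0\le\gamma<1$, $\Omega_\gamma=\{z\in\mathbb{C}:|z+\frac{\gamma}{1-\gamma}|<\frac{1}{1-\gamma}\}$, which contains $\mathbb{D}$. *)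

(* Defs.v *)
From Stdlib Require Import Reals.
From Coquelicot Require Import Coquelicot.
Open Scope R_scope.

Definition unit_disk (z : C) : Prop := Cmod z < 1.

Definition Omega (gamma : R) (z : C) : Prop :=
  Cmod (Cplus z (RtoC (gamma / (1 - gamma)))) < 1 / (1 - gamma).

Definition analytic_on (U : C -> Prop) (f : C -> C) : Prop :=
  forall z, U z -> ex_derive (K := C_AbsRing) (V := C_NormedModule) f z.

(* Main.v *)
Require Import Defs.
From Stdlib Require Import Reals Psatz Classical ClassicalEpsilon.
From Coquelicot Require Import Coquelicot.
Open Scope R_scope.

(** The Moebius map [w |-> z = (1 + gamma) w / (1 + gamma w)] carries the unit disk onto
    [Omega gamma] and fixes 0. For [f] analytic and bounded by 1 on [Omega gamma], put [G w
    = f z]. The Laurent coefficients [d_k], the means of [G w / w^k], satisfy [|d_k| <= 1 -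
    |d_0|^2], and Cauchy's formula in the variable [w] writes [(1 + gamma)^n a_n] as the
    mean of [(1 + gamma w)^(n-1) G w / w^n], a combination of [d_1, ..., d_n] with
    nonnegative weights of sum [(1 + gamma)^(n-1)]. Hence [(1 + gamma) |a_n| <= 1 -
    |a_0|^2].

    For the pair [(h, g)] this is applied to [h + eps g] and [h - eps g] with [|eps| = 1]
    chosen so that [a_0] and [eps b_0] are orthogonal; the parallelogram law then gives [(1
    + gamma) sqrt (|a_n|^2 + |b_n|^2) <= 1 - A^2] with [A = sqrt (|a_0|^2 + |b_0|^2)]. For
    [r <= r_0] one has [r / (1 - r) <= (1 + gamma) / 2], so the sum is at most [A + (1 -
    A^2) / 2 <= 1].

    Circle means of a function holomorphic in the punctured disk do not depend on the
    radius: in logarithmic polar coordinates this is Goursat's theorem on a rectangle,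
    applied to a function periodic in the angle. *)

(** * Nested intervals and bisection of rectangles *)

Lemma nested_intervals (u v : nat -> R) :
  (forall n, u n <= u (S n)) -> (forall n, v (S n) <= v n) ->
  (forall n, u n <= v n) -> exists L, forall n, u n <= L <= v n.
Proof.
  intros Hu Hv Huv.
  assert (Hu' : forall n k, u n <= u (n + k)%nat).
  { intros n k; induction k as [|k IH].
    - rewrite Nat.add_0_r; lra.
    - rewrite Nat.add_succ_r; specialize (Hu (n + k)%nat); lra. }
  assert (Hv' : forall n k, v (n + k)%nat <= v n).
  { intros n k; induction k as [|k IH].
    - rewrite Nat.add_0_r; lra.
    - rewrite Nat.add_succ_r; specialize (Hv (n + k)%nat); lra. }
  assert (Hub : forall m n, u n <= v m).
  { intros m n. apply Rle_trans with (u (n + m)%nat); [apply Hu'|].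
    apply Rle_trans with (v (n + m)%nat); [apply Huv|].
    rewrite Nat.add_comm; apply Hv'. }
  destruct (completeness (fun x => exists n, x = u n)) as [L [HL1 HL2]].
  - exists (v 0%nat). intros x [n ->]. apply Hub.
  - exists (u 0%nat); now exists 0%nat.
  - exists L. intros n. split.
    + apply HL1; now exists n.
    + apply HL2. intros x [m ->]. apply Hub.
Qed.

(** If some cell were bad, one of its four quarters would be bad as well; the nested bad cells
    shrink to a point [(u, v)], and the local hypothesis there rules out the small ones. A cell is
    coded by its lower left corner and a scale [t], its sides being [w * t] and [l * t], so all
    cells are similar to one rectangle. *)
Lemma bisection_principle (K : R -> R -> R -> Prop) (w l : R) :
  0 <= w -> 0 <= l ->
  (forall x y t, 0 < t ->
     K x y (t / 2) -> K (x + w * (t / 2)) y (t / 2) ->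
     K x (y + l * (t / 2)) (t / 2) ->
     K (x + w * (t / 2)) (y + l * (t / 2)) (t / 2) -> K x y t) ->
  (forall u v, exists delta, 0 < delta /\ forall x y t, 0 < t < delta ->
     x <= u <= x + w * t -> y <= v <= y + l * t -> K x y t) ->
  forall x y t, 0 < t -> K x y t.
Proof.
  intros Hw Hl Hsub Hloc x0 y0 t0 Ht0.
  apply NNPP; intros Hbad.
  (* The relation is conditional on badness, so every triple has a successor and the choice function
     [F] below is total; [(0, 0, 0)] is the default for triples that are not bad. *)
  pose (good := fun q q' : R * R * R =>
    let '(x, y, t) := q in let '(x', y', t') := q' in
    0 < t -> ~ K x y t ->
    t' = t / 2 /\ ~ K x' y' t' /\ x <= x' <= x + w * (t / 2) /\
    y <= y' <= y + l * (t / 2)).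
  assert (Hgood : forall q, exists q', good q q').
  { intros [[x y] t].
    destruct (classic (K x y (t / 2) /\ K (x + w * (t / 2)) y (t / 2) /\
     K x (y + l * (t / 2)) (t / 2) /\
     K (x + w * (t / 2)) (y + l * (t / 2)) (t / 2))) as [HK|HK].
    - exists (0, 0, 0). intros Ht HnK. exfalso. apply HnK, Hsub; tauto.
    - apply not_and_or in HK.
      destruct (Rle_lt_dec t 0) as [Ht|Ht].
      { exists (0, 0, 0). intros Ht'; lra. }
      assert (0 <= w * (t / 2)) by (apply Rmult_le_pos; lra).
      assert (0 <= l * (t / 2)) by (apply Rmult_le_pos; lra).
      destruct HK as [HK|HK].
      { exists (x, y, t / 2). intros _ _. repeat split; try easy; lra. }
      apply not_and_or in HK. destruct HK as [HK|HK].
      { exists (x + w * (t / 2), y, t / 2). intros _ _. repeat split; try easy; lra. }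
      apply not_and_or in HK. destruct HK as [HK|HK].
      { exists (x, y + l * (t / 2), t / 2). intros _ _. repeat split; try easy; lra. }
      exists (x + w * (t / 2), y + l * (t / 2), t / 2). intros _ _.
      repeat split; try easy; lra. }
  pose (F := fun q => proj1_sig (constructive_indefinite_description _ (Hgood q))).
  assert (HF : forall q, good q (F q)).
  { intros q. exact (proj2_sig (constructive_indefinite_description _ (Hgood q))). }
  clearbody F.
  pose (s := fun n => Nat.iter n F (x0, y0, t0)).
  pose (X := fun n => fst (fst (s n))).
  pose (Y := fun n => snd (fst (s n))).
  pose (T := fun n => snd (s n)).
  assert (Hs : forall n, 0 < T n /\ ~ K (X n) (Y n) (T n)).
  { induction n as [|n [IH1 IH2]].
    - now split.
    - generalize (HF (s n)). unfold good, X, Y, T in *.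
      change (s (S n)) with (F (s n)).
      destruct (s n) as [[x y] t]; destruct (F (x, y, t)) as [[x' y'] t'].
      simpl in *. intros H. destruct (H IH1 IH2) as (H1 & H2 & _).
      split; [lra | exact H2]. }
  assert (Hstep : forall n, T (S n) = T n / 2 /\
    X n <= X (S n) <= X n + w * (T n / 2) /\
    Y n <= Y (S n) <= Y n + l * (T n / 2)).
  { intros n. destruct (Hs n) as [IH1 IH2].
    generalize (HF (s n)). unfold good, X, Y, T in *.
    change (s (S n)) with (F (s n)).
    destruct (s n) as [[x y] t]; destruct (F (x, y, t)) as [[x' y'] t'].
    simpl in *. intros H. destruct (H IH1 IH2) as (H1 & _ & H3 & H4).
    tauto. }
  destruct (nested_intervals X (fun n => X n + w * T n)) as [u Hu].
  { intros n; apply Hstep. }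
  { intros n. destruct (Hstep n) as (-> & H & _). lra. }
  { intros n. destruct (Hs n) as [H _]. assert (0 <= w * T n) by (apply Rmult_le_pos; lra). lra. }
  destruct (nested_intervals Y (fun n => Y n + l * T n)) as [v Hv].
  { intros n; apply Hstep. }
  { intros n. destruct (Hstep n) as (-> & _ & H). lra. }
  { intros n. destruct (Hs n) as [H _]. assert (0 <= l * T n) by (apply Rmult_le_pos; lra). lra. }
  destruct (Hloc u v) as (delta & Hd & HK).
  assert (HT : forall n, T n = t0 * (1 / 2) ^ n).
  { induction n as [|n IH].
    - unfold T; simpl; ring.
    - destruct (Hstep n) as (-> & _). rewrite IH. simpl. field. }
  assert (Hsmall : exists n, T n < delta).
  { destruct (pow_lt_1_zero (1 / 2)) with (y := delta / t0) as [n Hn].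
    - rewrite Rabs_pos_eq; lra.
    - now apply Rdiv_lt_0_compat.
    - exists n. rewrite HT. specialize (Hn n (le_n n)).
      rewrite Rabs_pos_eq in Hn by (apply pow_le; lra).
      apply Rmult_lt_compat_l with (r := t0) in Hn; [|lra].
      replace (t0 * (delta / t0)) with delta in Hn by (field; lra). lra. }
  destruct Hsmall as [n Hn].
  apply (proj2 (Hs n)), HK.
  - split; [apply Hs | exact Hn].
  - apply Hu.
  - apply Hv.
Qed.

(** * Closed one-forms on rectangles *)

Lemma RInt_near_const (f : R -> R) (a b c M : R) :
  a <= b -> ex_RInt f a b ->
  (forall x, a <= x <= b -> Rabs (f x - c) <= M) ->
  Rabs (RInt f a b - c * (b - a)) <= M * (b - a).
Proof.
  intros Hab Hf HM.
  assert (Hc : forall k, is_RInt (fun _ => k) a b (k * (b - a))).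
  { intros k. rewrite Rmult_comm. apply (is_RInt_const a b k). }
  pose proof (RInt_correct f a b Hf) as Hi.
  assert (H1 := is_RInt_le _ _ _ _ _ _ Hab Hi (Hc (c + M))).
  assert (H2 := is_RInt_le _ _ _ _ _ _ Hab (Hc (c - M)) Hi).
  apply Rabs_le. split.
  - assert (H : (c - M) * (b - a) <= RInt f a b).
    { apply H2. intros x Hx. assert (Hx' : a <= x <= b) by lra.
      apply HM, Rabs_le_between in Hx'. lra. }
    lra.
  - assert (H : RInt f a b <= (c + M) * (b - a)).
    { apply H1. intros x Hx. assert (Hx' : a <= x <= b) by lra.
      apply HM, Rabs_le_between in Hx'. lra. }
    lra.
Qed.

(* The form [P dx + Q dy] is closed in the pointwise sense [dP/dy = dQ/dx], with no
   continuity of the derivatives. *)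
Definition closed_form (P Q : R -> R -> R) (x1 x2 y1 y2 : R) : Prop :=
  forall x y, x1 <= x <= x2 -> y1 <= y <= y2 ->
  exists p s q, differentiable_pt_lim P x y p s /\ differentiable_pt_lim Q x y s q.

(** The counterclockwise boundary integral of [P dx + Q dy]. Opposite sides are paired under one
    integral, so that each integrand is a difference across the rectangle. *)
Definition circulation (P Q : R -> R -> R) (x1 x2 y1 y2 : R) : R :=
  RInt (fun x => P x y1 - P x y2) x1 x2 + RInt (fun y => Q x2 y - Q x1 y) y1 y2.

Lemma continuity_2d_pt_sections (f : R -> R -> R) (x y : R) :
  continuity_2d_pt f x y ->
  continuous (fun u => f u y) x /\ continuous (fun v => f x v) y.
Proof.
  intros H. split; apply filterlim_locally; intros eps; destruct (H eps) as [d Hd];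
    exists d; intros z Hz; apply Hd;
    try exact Hz; rewrite Rminus_diag, Rabs_R0; apply cond_pos.
Qed.

Lemma closed_form_ex_RInt (P Q : R -> R -> R) (x1 x2 y1 y2 : R) :
  closed_form P Q x1 x2 y1 y2 ->
  (forall y a b, y1 <= y <= y2 -> x1 <= a <= x2 -> x1 <= b <= x2 ->
     ex_RInt (fun x => P x y) a b) /\
  (forall x a b, x1 <= x <= x2 -> y1 <= a <= y2 -> y1 <= b <= y2 ->
     ex_RInt (fun y => Q x y) a b).
Proof.
  intros H.
  assert (Hc : forall x y, x1 <= x <= x2 -> y1 <= y <= y2 ->
    continuity_2d_pt P x y /\ continuity_2d_pt Q x y).
  { intros x y Hx Hy. destruct (H x y Hx Hy) as (p & s & q & HP & HQ).
    split; apply differentiable_continuity_pt; eexists; eexists; eassumption. }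
  split.
  - intros y a b Hy Ha Hb. apply (@ex_RInt_continuous R_CompleteNormedModule).
    intros z Hz.
    apply (continuity_2d_pt_sections P z y), Hc; [|easy].
    revert Hz; unfold Rmin, Rmax; destruct (Rle_dec a b); lra.
  - intros x a b Hx Ha Hb. apply (@ex_RInt_continuous R_CompleteNormedModule).
    intros z Hz.
    apply (continuity_2d_pt_sections Q x z), Hc; [easy|].
    revert Hz; unfold Rmin, Rmax; destruct (Rle_dec a b); lra.
Qed.

(** The two smaller boundaries run along the common side at [m] in opposite directions, so its
    contributions cancel. *)
Lemma circulation_split_x (P Q : R -> R -> R) (x1 x2 y1 y2 a m b c d : R) :
  closed_form P Q x1 x2 y1 y2 ->
  x1 <= a -> a <= m -> m <= b -> b <= x2 -> y1 <= c -> c <= d -> d <= y2 ->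
  circulation P Q a b c d = circulation P Q a m c d + circulation P Q m b c d.
Proof.
  intros H H1 H2 H3 H4 H5 H6 H7. destruct (closed_form_ex_RInt _ _ _ _ _ _ H) as [HP HQ].
  unfold circulation.
  rewrite <- (RInt_Chasles (fun x => P x c - P x d) a m b)
    by (apply (ex_RInt_minus (V := R_NormedModule)); apply HP; lra).
  rewrite !(RInt_minus (V := R_CompleteNormedModule) (fun y => Q _ y) (fun y => Q _ y))
    by (apply HQ; lra).
  unfold plus, minus, opp; simpl; unfold plus, opp; simpl; ring.
Qed.

Lemma circulation_split_y (P Q : R -> R -> R) (x1 x2 y1 y2 a b c m d : R) :
  closed_form P Q x1 x2 y1 y2 ->
  x1 <= a -> a <= b -> b <= x2 -> y1 <= c -> c <= m -> m <= d -> d <= y2 ->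
  circulation P Q a b c d = circulation P Q a b c m + circulation P Q a b m d.
Proof.
  intros H H1 H2 H3 H4 H5 H6 H7. destruct (closed_form_ex_RInt _ _ _ _ _ _ H) as [HP HQ].
  unfold circulation.
  rewrite <- (RInt_Chasles (fun y => Q b y - Q a y) c m d)
    by (apply (ex_RInt_minus (V := R_NormedModule)); apply HQ; lra).
  rewrite !(RInt_minus (V := R_CompleteNormedModule) (fun x => P x _) (fun x => P x _))
    by (apply HP; lra).
  unfold plus, minus, opp; simpl; unfold plus, opp; simpl; ring.
Qed.

(** The affine part of the form at [(u, v)] contributes [- s * (l * t)] over a width [w * t] and
    [s * (w * t)] over a height [l * t], which cancel because the same [s] is [dP/dy] and [dQ/dx].
    The remainder is [o(t)] on a boundary of length [O(t)]. *)
Lemma circulation_local (P Q : R -> R -> R) (u v p s q w l e : R) :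
  0 <= w -> 0 <= l -> 0 < e ->
  differentiable_pt_lim P u v p s -> differentiable_pt_lim Q u v s q ->
  exists delta, 0 < delta /\ forall x y t, 0 < t < delta ->
    x <= u <= x + w * t -> y <= v <= y + l * t ->
    ex_RInt (fun z => P z y - P z (y + l * t)) x (x + w * t) ->
    ex_RInt (fun z => Q (x + w * t) z - Q x z) y (y + l * t) ->
    Rabs (circulation P Q x (x + w * t) y (y + l * t)) <= e * t ^ 2.
Proof.
  intros Hw Hl He HP HQ.
  set (D := w + l + 1).
  assert (HD : 0 < D) by (unfold D; lra).
  (* Points of the cell lie within [D * t] of [(u, v)] in the max norm; with this [eta] the total
     error [2 * (eta * (D * t)) * (D * t)] is exactly [e * t ^ 2]. The summand 1 keeps [D] positive
     for a degenerate rectangle. *)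
  assert (Heta : 0 < e / (2 * D ^ 2)).
  { apply Rdiv_lt_0_compat; [lra|]. pose proof (pow_lt D 2 HD). lra. }
  destruct (HP (mkposreal _ Heta)) as [d1 Hd1].
  destruct (HQ (mkposreal _ Heta)) as [d2 Hd2].
  simpl in Hd1, Hd2.
  set (eta := e / (2 * D ^ 2)) in *.
  pose proof (cond_pos d1) as Hd1p. pose proof (cond_pos d2) as Hd2p.
  set (d := Rmin d1 d2).
  assert (Hd : 0 < d) by (apply Rmin_pos; easy).
  exists (d / D). split; [now apply Rdiv_lt_0_compat|].
  intros x y t [Ht Htd] Hxu Hyv HiP HiQ.
  assert (HDt : D * t < d).
  { apply Rmult_lt_compat_l with (r := D) in Htd; [|easy].
    replace (D * (d / D)) with d in Htd by (field; lra). exact Htd. }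
  assert (Hwt : 0 <= w * t) by (apply Rmult_le_pos; lra).
  assert (Hlt : 0 <= l * t) by (apply Rmult_le_pos; lra).
  assert (HDe : D * t = w * t + l * t + t) by (unfold D; ring).
  pose proof (Rmin_l d1 d2). pose proof (Rmin_r d1 d2). fold d in H, H0.
  assert (Hmax : forall x' y', x <= x' <= x + w * t -> y <= y' <= y + l * t ->
    Rabs (x' - u) < d /\ Rabs (y' - v) < d /\
    Rmax (Rabs (x' - u)) (Rabs (y' - v)) <= D * t).
  { intros x' y' Hx' Hy'.
    assert (Rabs (x' - u) <= w * t) by (apply Rabs_le; lra).
    assert (Rabs (y' - v) <= l * t) by (apply Rabs_le; lra).
    repeat split; try lra. apply Rmax_lub; lra. }
  assert (EP : forall x' y', x <= x' <= x + w * t -> y <= y' <= y + l * t ->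
    Rabs (P x' y' - P u v - (p * (x' - u) + s * (y' - v))) <= eta * (D * t)).
  { intros x' y' Hx' Hy'. destruct (Hmax x' y' Hx' Hy') as (A & B & M).
    eapply Rle_trans; [apply Hd1; lra|]. apply Rmult_le_compat_l; lra. }
  assert (EQ : forall x' y', x <= x' <= x + w * t -> y <= y' <= y + l * t ->
    Rabs (Q x' y' - Q u v - (s * (x' - u) + q * (y' - v))) <= eta * (D * t)).
  { intros x' y' Hx' Hy'. destruct (Hmax x' y' Hx' Hy') as (A & B & M).
    eapply Rle_trans; [apply Hd2; lra|]. apply Rmult_le_compat_l; lra. }
  assert (IP := RInt_near_const _ x (x + w * t) (- s * (l * t)) (2 * (eta * (D * t)))
    ltac:(lra) HiP).
  assert (IQ := RInt_near_const _ y (y + l * t) (s * (w * t)) (2 * (eta * (D * t)))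
    ltac:(lra) HiQ).
  unfold circulation.
  set (I1 := RInt _ x _) in *. set (I2 := RInt _ y _) in *.
  lapply IP; [clear IP; intros IP|].
  2:{ intros z Hz. pose proof (EP z y Hz ltac:(lra)) as A.
      pose proof (EP z (y + l * t) Hz ltac:(lra)) as B.
      apply Rabs_le_between in A. apply Rabs_le_between in B.
      apply Rabs_le. lra. }
  lapply IQ; [clear IQ; intros IQ|].
  2:{ intros z Hz. pose proof (EQ x z ltac:(lra) Hz) as A.
      pose proof (EQ (x + w * t) z ltac:(lra) Hz) as B.
      apply Rabs_le_between in A. apply Rabs_le_between in B.
      apply Rabs_le. lra. }
  apply Rabs_le_between in IP. apply Rabs_le_between in IQ.
  assert (Hfin : 2 * (eta * (D * t)) * (w * t + l * t) <= e * t ^ 2).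
  { apply Rle_trans with (2 * (eta * (D * t)) * (D * t)).
    - apply Rmult_le_compat_l; [|lra].
      assert (0 <= eta * (D * t)); [|lra].
      apply Rmult_le_pos; [lra|]. apply Rmult_le_pos; lra.
    - apply Req_le. unfold eta. field. lra. }
  apply Rabs_le. lra.
Qed.

(* Goursat's theorem, with the Cauchy-Riemann pair replaced by a real one-form. *)
Lemma circulation_closed_form (P Q : R -> R -> R) (x1 x2 y1 y2 : R) :
  x1 <= x2 -> y1 <= y2 -> closed_form P Q x1 x2 y1 y2 ->
  circulation P Q x1 x2 y1 y2 = 0.
Proof.
  intros Hx Hy H. destruct (closed_form_ex_RInt _ _ _ _ _ _ H) as [HP HQ].
  set (w := x2 - x1). set (l := y2 - y1).
  assert (Hw : 0 <= w) by (unfold w; lra). assert (Hl : 0 <= l) by (unfold l; lra).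
  assert (He : forall e, 0 < e -> Rabs (circulation P Q x1 x2 y1 y2) <= e).
  2:{ destruct (Req_dec (circulation P Q x1 x2 y1 y2) 0) as [E|E]; [easy|].
      apply Rabs_pos_lt in E. specialize (He (Rabs (circulation P Q x1 x2 y1 y2) / 2)).
      lra. }
  intros e He.
  (* The bound scales like area, so the bounds for four quarters add up to the bound for the cell.
     The containment premises make [K] vacuous for cells that leave the rectangle, which settles
     points [(u, v)] outside it. *)
  pose (K := fun x y t => x1 <= x -> x + w * t <= x2 -> y1 <= y -> y + l * t <= y2 ->
    Rabs (circulation P Q x (x + w * t) y (y + l * t)) <= e * t ^ 2).
  assert (HK : forall x y t, 0 < t -> K x y t).
  { apply (bisection_principle K w l Hw Hl).
    - intros x y t Ht K1 K2 K3 K4 A B C D.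
      assert (Hwt : 0 <= w * (t / 2)) by (apply Rmult_le_pos; lra).
      assert (Hlt : 0 <= l * (t / 2)) by (apply Rmult_le_pos; lra).
      replace (x + w * t) with (x + w * (t / 2) + w * (t / 2)) in * by field.
      replace (y + l * t) with (y + l * (t / 2) + l * (t / 2)) in * by field.
      unfold K in *.
      rewrite (circulation_split_x P Q x1 x2 y1 y2 x (x + w * (t / 2))) by (easy || lra).
      rewrite (circulation_split_y P Q x1 x2 y1 y2 x _ y (y + l * (t / 2))) by (easy || lra).
      rewrite (circulation_split_y P Q x1 x2 y1 y2 (x + w * (t / 2)) _ y (y + l * (t / 2)))
        by (easy || lra).
      specialize (K1 ltac:(lra) ltac:(lra) ltac:(lra) ltac:(lra)).
      specialize (K2 ltac:(lra) ltac:(lra) ltac:(lra) ltac:(lra)).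
      specialize (K3 ltac:(lra) ltac:(lra) ltac:(lra) ltac:(lra)).
      specialize (K4 ltac:(lra) ltac:(lra) ltac:(lra) ltac:(lra)).
      apply Rabs_le_between in K1, K2, K3, K4.
      replace (e * t ^ 2) with (4 * (e * (t / 2) ^ 2)) by field.
      apply Rabs_le. lra.
    - intros u v.
      destruct (classic (x1 <= u <= x2 /\ y1 <= v <= y2)) as [[Hu Hv]|Hout].
      + destruct (H u v Hu Hv) as (p & s & q & DP & DQ).
        destruct (circulation_local P Q u v p s q w l e Hw Hl He DP DQ) as (d & Hd & HK).
        exists d. split; [easy|]. intros x y t Ht Hxu Hyv A B C D.
        apply HK; try easy; apply (ex_RInt_minus (V := R_NormedModule)).
        * apply HP; lra.
        * apply HP; lra.
        * apply HQ; lra.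
        * apply HQ; lra.
      + exists 1. split; [lra|]. intros x y t Ht Hxu Hyv A B C D.
        exfalso. apply Hout. lra. }
  assert (E := HK x1 y1 1 Rlt_0_1). unfold K in E.
  replace (x1 + w * 1) with x2 in E by (unfold w; ring).
  replace (y1 + l * 1) with y2 in E by (unfold l; ring).
  specialize (E ltac:(lra) ltac:(lra) ltac:(lra) ltac:(lra)). lra.
Qed.

(** * Complex differentiability *)

(* Coquelicot's product and chain rules need the target module to be [C_AbsRing] itself,
   while [C_NormedModule] carries the uniform structure of [R * R]. *)
Definition holo (f : C -> C) (z : C) : Prop :=
  @ex_derive C_AbsRing (AbsRing_NormedModule C_AbsRing) f z.

(** First-order expansion with derivative [l], stated through [Cmod] alone; it serves as the bridge
    between [ex_derive] over [C_NormedModule] and [holo]. *)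
Definition expansion (f : C -> C) (z l : C) : Prop :=
  forall eps, 0 < eps -> exists delta, 0 < delta /\ forall w, Cmod (w - z) < delta ->
    Cmod (f w - f z - (w - z) * l) <= eps * Cmod (w - z).

Lemma expansion_holo (f : C -> C) (z l : C) : expansion f z l -> holo f z.
Proof.
  intros H. exists l. split.
  - apply is_linear_scal_l.
  - intros x Hx. apply (is_filter_lim_locally_unique (V := AbsRing_NormedModule C_AbsRing)) in Hx.
    rewrite <- Hx. clear x Hx.
    intros eps. destruct (H eps (cond_pos eps)) as (d & Hd & Hw).
    exists (mkposreal d Hd). intros w Hb. apply (Hw w Hb).
Qed.

Lemma ex_derive_expansion (f : C -> C) (z : C) :
  @ex_derive C_AbsRing C_NormedModule f z -> exists l, expansion f z l.
Proof.
  intros [l [_ H]]. exists l. intros eps He.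
  destruct (H z (fun P HP => HP) (mkposreal eps He)) as [d Hd].
  exists d. split; [apply cond_pos|]. intros w Hw. apply (Hd w Hw).
Qed.

Lemma holo_expansion (f : C -> C) (z : C) : holo f z -> exists l, expansion f z l.
Proof.
  intros [l [_ H]]. exists l. intros eps He.
  destruct (H z (fun P HP => HP) (mkposreal eps He)) as [d Hd].
  exists d. split; [apply cond_pos|]. intros w Hw. apply (Hd w Hw).
Qed.

Lemma holo_const (c z : C) : holo (fun _ => c) z.
Proof. exists zero. apply (is_derive_const (V := AbsRing_NormedModule C_AbsRing)). Qed.

Lemma holo_id (z : C) : holo (fun w => w) z.
Proof. exists one. apply (is_derive_id (K := C_AbsRing)). Qed.

Lemma holo_plus (f g : C -> C) (z : C) : holo f z -> holo g z -> holo (fun w => f w + g w)%C z.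
Proof.
  intros [l Hl] [m Hm]. exists (plus l m).
  apply (is_derive_plus (V := AbsRing_NormedModule C_AbsRing)); assumption.
Qed.

Lemma holo_mult (f g : C -> C) (z : C) : holo f z -> holo g z -> holo (fun w => f w * g w)%C z.
Proof.
  intros [l Hl] [m Hm]. eexists. apply (is_derive_mult (K := C_AbsRing)); try eassumption.
  intros; apply Cmult_comm.
Qed.

Lemma holo_comp (f g : C -> C) (z : C) : holo f (g z) -> holo g z -> holo (fun w => f (g w)) z.
Proof.
  intros [l Hl] [m Hm]. eexists.
  apply (is_derive_comp (V := AbsRing_NormedModule C_AbsRing) f g); eassumption.
Qed.

Lemma Cmod_diff (a b : C) : Cmod a - Cmod b <= Cmod (a - b).
Proof.
  pose proof (Cmod_triangle (a - b) b) as H. replace (a - b + b)%C with a in H by ring. lra.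
Qed.

Lemma Cmod_minus_sym (a b : C) : Cmod (a - b) = Cmod (b - a).
Proof. rewrite <- Cmod_opp. f_equal. ring. Qed.

Lemma holo_Cinv (z : C) : z <> 0 -> holo Cinv z.
Proof.
  intros Hz. apply (expansion_holo _ _ (- / (z * z)))%C. intros eps He.
  assert (Hm : 0 < Cmod z) by exact (proj1 (Cmod_gt_0 z) Hz).
  set (m := Cmod z) in *.
  assert (0 < m ^ 3) by (apply pow_lt; easy).
  (* The error is [(w - z)^2 / (w * z^2)]. The radius [m / 2] keeps [Cmod w] at least [m / 2], and
     then [eps * m ^ 3 / 2] is at most [eps * Cmod w * m ^ 2]. *)
  exists (Rmin (m / 2) (eps * m ^ 3 / 2)). split.
  - apply Rmin_pos; [lra|]. pose proof (Rmult_lt_0_compat _ _ He H). lra.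
  - intros w Hw.
    assert (H1 := Rlt_le_trans _ _ _ Hw (Rmin_l _ _)).
    assert (H2 := Rlt_le_trans _ _ _ Hw (Rmin_r _ _)). clear Hw.
    assert (Hwm : m / 2 <= Cmod w).
    { pose proof (Cmod_diff z w) as D. rewrite Cmod_minus_sym in D. fold m in D. lra. }
    assert (Hw0 : w <> 0) by (apply (proj2 (Cmod_gt_0 w)); lra).
    replace (/ w - / z - (w - z) * - / (z * z))%C
      with ((w - z) * ((w - z) * / (w * (z * z))))%C by (field; now split).
    rewrite 2!Cmod_mult, Cmod_inv, 2!Cmod_mult
      by (repeat apply Cmult_neq_0; assumption).
    fold m. rewrite Rmult_comm. apply Rmult_le_compat_r; [apply Cmod_ge_0|].
    apply Rle_div_l; [apply Rlt_gt; repeat apply Rmult_lt_0_compat; lra|].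
    apply Rle_trans with (eps * (m / 2 * (m * m))).
    + replace (eps * (m / 2 * (m * m))) with (eps * m ^ 3 / 2) by field. lra.
    + apply Rmult_le_compat_l; [lra|]. apply Rmult_le_compat_r; [|easy].
      apply Rmult_le_pos; lra.
Qed.

Lemma holo_inv (f : C -> C) (z : C) : holo f z -> f z <> 0 -> holo (fun w => / f w)%C z.
Proof. intros Hf H. apply (holo_comp Cinv f); [now apply holo_Cinv | exact Hf]. Qed.

Lemma holo_pow (f : C -> C) (n : nat) (z : C) : holo f z -> holo (fun w => f w ^ n)%C z.
Proof.
  intros H. induction n as [|n IH].
  - apply (holo_const 1).
  - apply (holo_mult f (fun w => f w ^ n)%C); assumption.
Qed.

(** * Means over circles centred at 0 *)

Definition polar (rho theta : R) : C := (rho * cos theta, rho * sin theta).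

Lemma Cmod_polar (rho theta : R) : 0 <= rho -> Cmod (polar rho theta) = rho.
Proof.
  intros H. unfold Cmod, polar; simpl.
  replace (_ + _) with (rho ^ 2 * ((sin theta)² + (cos theta)²)) by (unfold Rsqr; ring).
  rewrite sin2_cos2, Rmult_1_r. now apply sqrt_pow2.
Qed.

(** A relation rather than a function, so that it asserts integrability together with the value. The
    mean is taken in the angle, hence the mean of [phi z / z ^ n] is the Laurent coefficient of
    index [n]. *)
Definition circle_mean (rho : R) (phi : C -> C) (l : C) : Prop :=
  is_RInt (fun t => Re (phi (polar rho t))) 0 (2 * PI) (2 * PI * Re l) /\
  is_RInt (fun t => Im (phi (polar rho t))) 0 (2 * PI) (2 * PI * Im l).

Lemma circle_mean_ext (rho : R) (phi psi : C -> C) (l m : C) :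
  0 < rho -> (forall z, Cmod z = rho -> phi z = psi z) -> l = m ->
  circle_mean rho phi l -> circle_mean rho psi m.
Proof.
  intros Hr H <- [H1 H2]. split; (eapply is_RInt_ext; [|eassumption]);
    intros t _; simpl; rewrite H; try easy; apply Cmod_polar; lra.
Qed.

Lemma circle_mean_plus (rho : R) (phi psi : C -> C) (l m : C) :
  circle_mean rho phi l -> circle_mean rho psi m ->
  circle_mean rho (fun z => phi z + psi z)%C (l + m)%C.
Proof.
  intros [H1 H2] [H3 H4]. split.
  - replace (2 * PI * Re (l + m)) with (plus (2 * PI * Re l) (2 * PI * Re m))
      by (unfold plus, Re; simpl; ring).
    exact (is_RInt_plus _ _ _ _ _ _ H1 H3).
  - replace (2 * PI * Im (l + m)) with (plus (2 * PI * Im l) (2 * PI * Im m))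
      by (unfold plus, Im; simpl; ring).
    exact (is_RInt_plus _ _ _ _ _ _ H2 H4).
Qed.

Lemma circle_mean_scal (rho : R) (phi : C -> C) (c l : C) :
  circle_mean rho phi l -> circle_mean rho (fun z => c * phi z)%C (c * l)%C.
Proof.
  intros [H1 H2]. split.
  - replace (2 * PI * Re (c * l))
      with (minus (scal (Re c) (2 * PI * Re l)) (scal (Im c) (2 * PI * Im l)))
      by (unfold minus, plus, opp, scal, mult, Re, Im; simpl; unfold mult; simpl; ring).
    apply (is_RInt_minus (V := R_NormedModule));
      apply (is_RInt_scal (V := R_NormedModule)); assumption.
  - replace (2 * PI * Im (c * l))
      with (plus (scal (Re c) (2 * PI * Im l)) (scal (Im c) (2 * PI * Re l)))
      by (unfold minus, plus, opp, scal, mult, Re, Im; simpl; unfold mult; simpl; ring).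
    apply (is_RInt_plus (V := R_NormedModule));
      apply (is_RInt_scal (V := R_NormedModule)); assumption.
Qed.

Lemma circle_mean_const (rho : R) (c : C) : circle_mean rho (fun _ => c) c.
Proof.
  assert (H : forall k, is_RInt (fun _ : R => k) 0 (2 * PI) (2 * PI * k)).
  { intros k. replace (2 * PI * k) with (scal (2 * PI - 0) k)
      by (unfold scal; simpl; unfold mult; simpl; ring).
    apply (is_RInt_const 0 (2 * PI) k). }
  split; apply H.
Qed.

Lemma circle_mean_le (rho : R) (phi psi : C -> C) (l m : C) :
  0 < rho -> circle_mean rho phi l -> circle_mean rho psi m ->
  (forall z, Cmod z = rho -> Re (phi z) <= Re (psi z)) -> Re l <= Re m.
Proof.
  intros Hr [H1 _] [H2 _] H. pose proof PI_RGT_0.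
  apply Rmult_le_reg_l with (2 * PI); [lra|].
  assert (H2PI : 0 <= 2 * PI) by lra.
  apply (is_RInt_le _ _ _ _ _ _ H2PI H1 H2).
  intros t _. apply H, Cmod_polar. lra.
Qed.

Lemma circle_mean_dist_le (rho e : R) (phi : C -> C) (l c : C) :
  0 < rho -> circle_mean rho phi l ->
  (forall z, Cmod z = rho -> Cmod (phi z - c) <= e) ->
  Rabs (Re l - Re c) <= e /\ Rabs (Im l - Im c) <= e.
Proof.
  intros Hr [H1 H2] H. pose proof PI_RGT_0.
  assert (Hb : forall f v k, is_RInt f 0 (2 * PI) (2 * PI * v) ->
    (forall t, Rabs (f t - k) <= e) -> Rabs (v - k) <= e).
  { intros f v k Hf Hk.
    assert (E := RInt_near_const f 0 (2 * PI) k e ltac:(lra)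
      (ex_intro _ _ Hf) (fun t _ => Hk t)).
    rewrite (is_RInt_unique _ _ _ _ Hf) in E.
    replace (2 * PI * v - k * (2 * PI - 0)) with ((2 * PI) * (v - k)) in E by ring.
    rewrite Rabs_mult, (Rabs_pos_eq (2 * PI)) in E by lra.
    apply Rmult_le_reg_l with (2 * PI); lra. }
  assert (Hz : forall t, Cmod (phi (polar rho t) - c) <= e).
  { intros t. apply H, Cmod_polar. lra. }
  split; (eapply Hb; [eassumption|]); intros t; (eapply Rle_trans; [|apply (Hz t)]);
    (eapply Rle_trans; [|apply Rmax_Cmod]).
  - apply Rmax_l.
  - apply Rmax_r.
Qed.

Definition disk_mean (phi : C -> C) (l : C) : Prop :=
  forall rho, 0 < rho < 1 -> circle_mean rho phi l.

Lemma disk_mean_ext (phi psi : C -> C) (l m : C) :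
  (forall z, 0 < Cmod z < 1 -> phi z = psi z) -> l = m ->
  disk_mean phi l -> disk_mean psi m.
Proof.
  intros H E Hp rho Hr. apply (circle_mean_ext rho phi psi l m); try easy.
  - intros z <-. now apply H.
  - now apply Hp.
Qed.

Lemma disk_mean_plus (phi psi : C -> C) (l m : C) :
  disk_mean phi l -> disk_mean psi m -> disk_mean (fun z => phi z + psi z)%C (l + m)%C.
Proof. intros H1 H2 rho Hr. apply circle_mean_plus; auto. Qed.

Lemma disk_mean_scal (phi : C -> C) (c l : C) :
  disk_mean phi l -> disk_mean (fun z => c * phi z)%C (c * l)%C.
Proof. intros H rho Hr. apply circle_mean_scal; auto. Qed.

Definition limit_at_0 (phi : C -> C) (c : C) : Prop :=
  forall eps, 0 < eps -> exists delta, 0 < delta /\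
    forall z, 0 < Cmod z < delta -> Cmod (phi z - c) <= eps.

(** The mean is the same on every circle, so it may be computed on circles so small that [phi] is
    within [e] of [c]. *)
Lemma disk_mean_limit (phi : C -> C) (l c : C) :
  disk_mean phi l -> limit_at_0 phi c -> l = c.
Proof.
  intros Hm Hl.
  assert (H : forall e, 0 < e -> Rabs (Re l - Re c) <= e /\ Rabs (Im l - Im c) <= e).
  { intros e He. destruct (Hl e He) as (d & Hd & Hz).
    assert (Hr : 0 < Rmin (d / 2) (1 / 2)) by (apply Rmin_pos; lra).
    pose proof (Rmin_l (d / 2) (1 / 2)). pose proof (Rmin_r (d / 2) (1 / 2)).
    apply (circle_mean_dist_le (Rmin (d / 2) (1 / 2)) e phi l c Hr).
    - apply Hm; lra.
    - intros z Ez. apply Hz. lra. }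
  assert (H0 : forall x, (forall e, 0 < e -> Rabs x <= e) -> x = 0).
  { intros x Hx. destruct (Req_dec x 0) as [E|E]; [easy|].
    apply Rabs_pos_lt in E. specialize (Hx (Rabs x / 2)). lra. }
  assert (E1 : Re l - Re c = 0) by (apply H0; intros e He; now apply H).
  assert (E2 : Im l - Im c = 0) by (apply H0; intros e He; now apply H).
  destruct l, c; unfold Re, Im in *; simpl in *; f_equal; lra.
Qed.

(** * Cauchy-Riemann equations and independence of the radius *)

(** Multiplication by [p + i q] acts on the plane by the matrix with rows [(p, - q)] and
    [(q, p)]. *)
Lemma expansion_differentiable (f : C -> C) (x y p q : R) :
  expansion f (x, y) (p, q) ->
  differentiable_pt_lim (fun u v => Re (f (u, v))) x y p (- q) /\
  differentiable_pt_lim (fun u v => Im (f (u, v))) x y q p.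
Proof.
  intros H.
  assert (H' : forall eps : posreal, locally_2d (fun u v =>
    Cmod (f (u, v) - f (x, y) - ((u, v) - (x, y)) * (p, q))
      <= eps * Rmax (Rabs (u - x)) (Rabs (v - y))) x y).
  { intros eps. pose proof (cond_pos eps) as He.
    (* Halving [eps] and [d] absorbs the factor [sqrt 2 <= 2] between the modulus and the max
       norm. *)
    destruct (H (eps / 2) ltac:(lra)) as (d & Hd & Hw).
    assert (Hd2 : 0 < d / 2) by lra.
    exists (mkposreal _ Hd2). simpl. intros u v Hu Hv.
    assert (Hs : sqrt 2 <= 2).
    { rewrite <- (sqrt_pow2 2) at 2 by lra. apply sqrt_le_1_alt. lra. }
    pose proof (Cmod_2Rmax ((u, v) - (x, y))) as HC. simpl in HC.
    change (u + - x) with (u - x) in HC. change (v + - y) with (v - y) in HC.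
    set (M := Rmax (Rabs (u - x)) (Rabs (v - y))) in *.
    assert (HM : 0 <= M).
    { eapply Rle_trans; [apply (Rabs_pos (u - x)) | apply Rmax_l]. }
    assert (HMd : M < d / 2) by (apply Rmax_lub_lt; assumption).
    assert (HCM : Cmod ((u, v) - (x, y)) <= 2 * M).
    { eapply Rle_trans; [exact HC|]. now apply Rmult_le_compat_r. }
    eapply Rle_trans; [apply Hw; lra|].
    replace (eps * M) with (eps / 2 * (2 * M)) by field.
    apply Rmult_le_compat_l; lra. }
  split; intros eps; destruct (H' eps) as [d Hd]; exists d; intros u v Hu Hv;
    (eapply Rle_trans; [|apply (Hd u v Hu Hv)]);
    (eapply Rle_trans; [|apply Rmax_Cmod]).
  - eapply Rle_trans; [|apply Rmax_l]. apply Req_le. f_equal. simpl. unfold Re. ring.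
  - eapply Rle_trans; [|apply Rmax_r]. apply Req_le. f_equal. simpl. unfold Im. ring.
Qed.

Lemma differentiable_pt_lim_mult (x y : R) : differentiable_pt_lim Rmult x y y x.
Proof.
  intros eps. exists eps. intros u v Hu Hv.
  replace (u * v - x * y - (y * (u - x) + x * (v - y))) with ((u - x) * (v - y)) by ring.
  rewrite Rabs_mult. apply Rmult_le_compat; try apply Rabs_pos; [lra | apply Rmax_r].
Qed.

Lemma differentiable_pt_lim_swap (f : R -> R -> R) (x y p q : R) :
  differentiable_pt_lim f x y p q -> differentiable_pt_lim (fun u v => f v u) y x q p.
Proof.
  intros H eps. destruct (H eps) as [d Hd]. exists d. intros u v Hu Hv.
  rewrite Rmax_comm, (Rplus_comm (q * _)). now apply Hd.
Qed.

Lemma differentiable_pt_lim_prod (f g : R -> R) (x y p q : R) :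
  derivable_pt_lim f x p -> derivable_pt_lim g y q ->
  differentiable_pt_lim (fun u v => f u * g v) x y (g y * p) (f x * q).
Proof.
  intros Hf Hg.
  assert (H := differentiable_pt_lim_comp Rmult (fun u _ => f u) (fun _ v => g v) x y
    (g y) (f x) p 0 0 q (differentiable_pt_lim_mult _ _)
    (differentiable_pt_lim_proj1_0 f x y p Hf)
    (differentiable_pt_lim_swap _ _ _ _ _ (differentiable_pt_lim_proj1_0 g y x q Hg))).
  now rewrite !Rmult_0_r, Rplus_0_r, Rplus_0_l in H.
Qed.

(* Cauchy-Riemann equations in the logarithmic polar coordinates [exp (s + i t)]. *)
Lemma holo_log_polar (phi : C -> C) (s t : R) :
  holo phi (polar (exp s) t) ->
  exists p q,
    differentiable_pt_lim (fun s t => Re (phi (polar (exp s) t))) s t p (- q) /\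
    differentiable_pt_lim (fun s t => Im (phi (polar (exp s) t))) s t q p.
Proof.
  intros H. apply holo_expansion in H. destruct H as [[a b] H].
  apply expansion_differentiable in H. destruct H as [HR HI].
  assert (HX := differentiable_pt_lim_prod exp cos s t _ _
    (derivable_pt_lim_exp s) (derivable_pt_lim_cos t)).
  assert (HY := differentiable_pt_lim_prod exp sin s t _ _
    (derivable_pt_lim_exp s) (derivable_pt_lim_sin t)).
  assert (D1 := differentiable_pt_lim_comp _ _ _ _ _ _ _ _ _ _ _ HR HX HY).
  assert (D2 := differentiable_pt_lim_comp _ _ _ _ _ _ _ _ _ _ _ HI HX HY).
  exists (a * (cos t * exp s) + - b * (sin t * exp s)),
    (b * (cos t * exp s) + a * (sin t * exp s)).
  split.
  - replace (- (b * (cos t * exp s) + a * (sin t * exp s)))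
      with (a * (exp s * - sin t) + - b * (exp s * cos t)) by ring. exact D1.
  - replace (a * (cos t * exp s) + - b * (sin t * exp s))
      with (b * (exp s * - sin t) + a * (exp s * cos t)) by ring. exact D2.
Qed.

Lemma differentiable_pt_lim_opp (f : R -> R -> R) (x y p q : R) :
  differentiable_pt_lim f x y p q -> differentiable_pt_lim (fun u v => - f u v) x y (- p) (- q).
Proof.
  intros H eps. destruct (H eps) as [d Hd]. exists d. intros u v Hu Hv.
  rewrite <- Rabs_Ropp.
  replace (- (- f u v - - f x y - (- p * (u - x) + - q * (v - y))))
    with (f u v - f x y - (p * (u - x) + q * (v - y))) by ring.
  now apply Hd.
Qed.

(** By periodicity the integrals of [P] along the bottom and top sides cancel, so vanishing
    circulation equates the integrals of [Q] along the two vertical sides. *)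
Lemma closed_form_periodic (P Q : R -> R -> R) (s1 s2 T : R) :
  s1 <= s2 -> 0 <= T -> closed_form P Q s1 s2 0 T -> (forall s, P s 0 = P s T) ->
  ex_RInt (Q s1) 0 T /\ ex_RInt (Q s2) 0 T /\ RInt (Q s1) 0 T = RInt (Q s2) 0 T.
Proof.
  intros Hs HT H Hper. destruct (closed_form_ex_RInt _ _ _ _ _ _ H) as [_ HQ].
  assert (E1 : ex_RInt (Q s1) 0 T) by (apply (HQ s1); lra).
  assert (E2 : ex_RInt (Q s2) 0 T) by (apply (HQ s2); lra).
  repeat split; try assumption.
  assert (E := circulation_closed_form P Q s1 s2 0 T Hs HT H). unfold circulation in E.
  rewrite (RInt_ext _ (fun _ => 0)), RInt_const in E
    by (intros x _; rewrite Hper; apply Rminus_diag).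
  rewrite (RInt_minus (V := R_CompleteNormedModule) (Q s2) (Q s1)) in E by assumption.
  unfold scal, minus, plus, opp in E; simpl in E; unfold mult in E; simpl in E. lra.
Qed.

(** With [zeta = s + i t], the forms [Im phi ds + Re phi dt] and [- Re phi ds + Im phi dt] are the
    imaginary part and minus the real part of [phi (exp zeta) d zeta]. Both are closed by the
    Cauchy-Riemann equations, and [2 * PI]-periodic in [t]. *)
Lemma holo_disk_mean (phi : C -> C) :
  (forall z, 0 < Cmod z < 1 -> holo phi z) -> exists l, disk_mean phi l.
Proof.
  intros H. pose proof PI_RGT_0 as HPI.
  assert (Hpos : forall s t, s < 0 -> holo phi (polar (exp s) t)).
  { intros s t Hs. apply H. pose proof (exp_pos s). rewrite Cmod_polar by lra.
    split; [easy|]. rewrite <- exp_0. now apply exp_increasing. }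
  assert (H2PI : forall rho, polar rho 0 = polar rho (2 * PI)).
  { intros rho. unfold polar. now rewrite cos_2PI, sin_2PI, cos_0, sin_0. }
  assert (HR : forall s1 s2, s1 <= s2 -> s2 < 0 ->
    closed_form (fun s t => Im (phi (polar (exp s) t)))
      (fun s t => Re (phi (polar (exp s) t))) s1 s2 0 (2 * PI)).
  { intros s1 s2 H1 H2 s t Hs _. destruct (holo_log_polar phi s t) as (p & q & D1 & D2).
    - apply Hpos; lra.
    - exists q, p, (- q). now split. }
  assert (HI : forall s1 s2, s1 <= s2 -> s2 < 0 ->
    closed_form (fun s t => - Re (phi (polar (exp s) t)))
      (fun s t => Im (phi (polar (exp s) t))) s1 s2 0 (2 * PI)).
  { intros s1 s2 H1 H2 s t Hs _. destruct (holo_log_polar phi s t) as (p & q & D1 & D2).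
    - apply Hpos; lra.
    - exists (- p), q, p. split; [|easy].
      rewrite <- (Ropp_involutive q). now apply differentiable_pt_lim_opp. }
  pose (A := (fun s => RInt (fun t => Re (phi (polar (exp s) t))) 0 (2 * PI)) : R -> R).
  pose (B := (fun s => RInt (fun t => Im (phi (polar (exp s) t))) 0 (2 * PI)) : R -> R).
  assert (HA : forall s1 s2, s1 <= s2 -> s2 < 0 ->
    ex_RInt (fun t => Re (phi (polar (exp s1) t))) 0 (2 * PI) /\ A s1 = A s2).
  { intros s1 s2 H1 H2.
    destruct (closed_form_periodic _ _ s1 s2 (2 * PI) H1 ltac:(lra) (HR s1 s2 H1 H2))
      as (E1 & _ & E); [intros s; now rewrite H2PI|now split]. }
  assert (HB : forall s1 s2, s1 <= s2 -> s2 < 0 ->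
    ex_RInt (fun t => Im (phi (polar (exp s1) t))) 0 (2 * PI) /\ B s1 = B s2).
  { intros s1 s2 H1 H2.
    destruct (closed_form_periodic _ _ s1 s2 (2 * PI) H1 ltac:(lra) (HI s1 s2 H1 H2))
      as (E1 & _ & E); [intros s; now rewrite H2PI|now split]. }
  (* The circle of radius [exp (- 1)] serves as reference; any radius below 1 would do. *)
  exists (A (- 1) / (2 * PI), B (- 1) / (2 * PI)). intros rho Hr.
  assert (Hln : ln rho < 0) by (rewrite <- ln_1; apply ln_increasing; lra).
  rewrite <- (exp_ln rho) by lra. set (s := ln rho) in *.
  assert (EA : A s = A (- 1)).
  { destruct (Rle_dec s (- 1)); [apply HA; lra | symmetry; apply HA; lra]. }
  assert (EB : B s = B (- 1)).
  { destruct (Rle_dec s (- 1)); [apply HB; lra | symmetry; apply HB; lra]. }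
  split.
  - replace (2 * PI * Re _) with (A s) by (rewrite EA; unfold Re; simpl; field; lra).
    apply (RInt_correct (V := R_CompleteNormedModule)). apply (HA s s); lra.
  - replace (2 * PI * Im _) with (B s) by (rewrite EB; unfold Im; simpl; field; lra).
    apply (RInt_correct (V := R_CompleteNormedModule)). apply (HB s s); lra.
Qed.

Lemma disk_mean_unique (phi : C -> C) (l m : C) :
  disk_mean phi l -> disk_mean phi m -> l = m.
Proof.
  intros H1 H2. destruct (H1 (1 / 2) ltac:(lra)) as [A1 B1].
  destruct (H2 (1 / 2) ltac:(lra)) as [A2 B2]. pose proof PI_RGT_0.
  assert (E : forall f x y, is_RInt f 0 (2 * PI) (2 * PI * x) ->
    is_RInt f 0 (2 * PI) (2 * PI * y) -> x = y).
  { intros f x y Hx Hy. apply (Rmult_eq_reg_l (2 * PI)); [|lra].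
    now rewrite <- (is_RInt_unique _ _ _ _ Hx), <- (is_RInt_unique _ _ _ _ Hy). }
  assert (ER := E _ _ _ A1 A2). assert (EI := E _ _ _ B1 B2).
  destruct l, m; unfold Re, Im in *; simpl in *; now subst.
Qed.

(** * Laurent coefficients of functions bounded by 1 *)

Lemma Cmod_pos_neq_0 (z : C) : 0 < Cmod z -> z <> 0.
Proof. apply (proj2 (Cmod_gt_0 z)). Qed.

(** Boundedness of [G] forces [G z * z ^ S k] to tend to 0 at 0; thus the coefficients of negative
    index vanish. *)
Lemma disk_mean_mult_pow (G : C -> C) (k : nat) :
  (forall z, 0 < Cmod z < 1 -> holo G z) ->
  (forall z, 0 < Cmod z < 1 -> Cmod (G z) <= 1) ->
  disk_mean (fun z => G z * z ^ S k)%C 0.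
Proof.
  intros HG Hb. destruct (holo_disk_mean (fun z => G z * z ^ S k)%C) as [l Hl].
  { intros z Hz. apply holo_mult; [now apply HG|]. apply holo_pow, holo_id. }
  replace (RtoC 0) with l; [exact Hl|].
  apply (disk_mean_limit _ _ _ Hl). intros eps He.
  exists (Rmin eps 1). split; [apply Rmin_pos; lra|]. intros z [Hz1 Hz2].
  pose proof (Rmin_l eps 1). pose proof (Rmin_r eps 1).
  replace (G z * z ^ S k - 0)%C with (G z * z ^ S k)%C by ring.
  rewrite Cmod_mult, Cmod_pow. simpl pow.
  assert (Cmod z ^ k <= 1 ^ k) by (apply pow_incr; lra). rewrite pow1 in H1.
  assert (0 <= Cmod z ^ k) by (apply pow_le; lra).
  assert (Cmod (G z) <= 1) by (apply Hb; lra).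
  apply Rle_trans with (1 * (Cmod z * 1)); [|lra].
  apply Rmult_le_compat; try lra; [apply Cmod_ge_0 | apply Rmult_le_pos; lra|].
  apply Rmult_le_compat_l; lra.
Qed.

Lemma limit_disk_mean (G : C -> C) (a : C) :
  (forall z, 0 < Cmod z < 1 -> holo G z) -> limit_at_0 G a -> disk_mean G a.
Proof.
  intros HG Hl. destruct (holo_disk_mean G HG) as [l H].
  now rewrite <- (disk_mean_limit _ _ _ H Hl).
Qed.

Lemma exists_rotation (d : C) : exists c, Cmod c = 1 /\ (c * d)%C = RtoC (Cmod d).
Proof.
  destruct (Req_dec (Cmod d) 0) as [E|E].
  - exists 1. split; [apply Cmod_1|]. rewrite E, (Cmod_eq_0 d E). ring.
  - assert (Hd : RtoC (Cmod d) <> 0) by (intros H; apply E; now apply RtoC_inj).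
    exists (Cconj d / Cmod d)%C. split.
    + rewrite Cmod_div, Cmod_conj, Cmod_R, Rabs_pos_eq; [now field | apply Cmod_ge_0 | easy].
    + replace (Cconj d / Cmod d * d)%C with (d * Cconj d / Cmod d)%C by (field; easy).
      rewrite <- Cmod2_conj. rewrite RtoC_pow. simpl. field; easy.
Qed.

(* With [v = 1 + conj a conj c e], the bracket on the left is [c conj e v^2], so this is [Re
   (G u) <= |u|] for [u = c conj e v^2]. *)
Lemma extremal_kernel_bound (G a c e : C) :
  Cmod G <= 1 -> Cmod c = 1 -> Cmod e = 1 ->
  Re (G * (2 * Cconj a + c * Cconj e + Cconj a * Cconj a * Cconj c * e))
    <= Re (1 + a * Cconj a + 2 * (Cconj a * Cconj c * e)).
Proof.
  intros HG Hc He.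
  assert (Ec : (c * Cconj c = 1)%C) by (rewrite <- Cmod2_conj, Hc; f_equal; ring).
  assert (Ee : (e * Cconj e = 1)%C) by (rewrite <- Cmod2_conj, He; f_equal; ring).
  set (v := (1 + Cconj a * Cconj c * e)%C).
  replace (2 * Cconj a + c * Cconj e + Cconj a * Cconj a * Cconj c * e)%C
    with (c * Cconj e * (v * v))%C.
  2:{ unfold v.
      transitivity (c * Cconj e + 2 * (c * Cconj c) * (e * Cconj e) * Cconj a +
        (c * Cconj c) * (e * Cconj e) * Cconj a * Cconj a * Cconj c * e)%C; [ring|].
      rewrite Ec, Ee. ring. }
  apply Rle_trans with (Cmod v ^ 2).
  - eapply Rle_trans; [apply Rle_abs|]. eapply Rle_trans; [apply re_le_Cmod|].
    rewrite !Cmod_mult, Cmod_conj, Hc, He.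
    pose proof (pow2_ge_0 (Cmod v)).
    replace (Cmod G * (1 * 1 * (Cmod v * Cmod v))) with (Cmod G * Cmod v ^ 2) by ring.
    apply Rle_trans with (1 * Cmod v ^ 2); [|lra]. now apply Rmult_le_compat_r.
  - apply Req_le. change (Cmod v ^ 2) with (Re (RtoC (Cmod v ^ 2))).
    rewrite Cmod2_conj. unfold v.
    rewrite Cplus_conj, !Cmult_conj, !Cconj_conj.
    replace ((1 + Cconj a * Cconj c * e) * (Cconj 1 + a * c * Cconj e))%C
      with (1 + a * Cconj a * (c * Cconj c) * (e * Cconj e) +
        (Cconj a * Cconj c * e + Cconj (Cconj a * Cconj c * e)))%C.
    2:{ rewrite !Cmult_conj, !Cconj_conj.
        replace (Cconj 1) with (RtoC 1) by (unfold Cconj, RtoC; simpl; f_equal; ring). ring. }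
    rewrite Ec, Ee. set (x := (Cconj a * Cconj c * e)%C). set (y := (a * Cconj a)%C).
    unfold Re; simpl. ring.
Qed.

Lemma pow_ge_Bernoulli (x : R) (n : nat) : 0 <= x <= 1 -> 1 - INR n * (1 - x) <= x ^ n.
Proof.
  intros Hx. induction n as [|n IH].
  - simpl. lra.
  - rewrite S_INR. simpl pow. assert (x ^ n <= 1 ^ n) by (apply pow_incr; lra).
    rewrite pow1 in H. nra.
Qed.

(** This is the passage to the limit [rho -> 1], made explicit by Bernoulli's inequality at
    [rho = 1 - d]. *)
Lemma le_of_pow_mult_le (x B : R) (k : nat) :
  0 <= x -> (forall rho, 0 < rho < 1 -> rho ^ k * x <= B) -> x <= B.
Proof.
  intros Hx H. destruct (Rle_dec x B) as [|E]; [easy|]. exfalso.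
  set (N := INR k + 1). assert (HN : 1 <= N) by (unfold N; pose proof (pos_INR k); lra).
  assert (HB : 0 <= B).
  { eapply Rle_trans; [|apply (H (1 / 2)); lra]. apply Rmult_le_pos; [apply pow_le|]; lra. }
  (* Chosen so that [N * d * x] is half the gap [x - B]; then [(1 - d) ^ k * x] stays above [B]. The
     bound [0 <= B] ensures [d < 1]. *)
  set (d := (x - B) / (2 * N * x)).
  assert (Hd : 0 < d) by (apply Rdiv_lt_0_compat; nra).
  assert (Hdx : d * (2 * N * x) = x - B) by (unfold d; field; lra).
  assert (HNx : x <= N * x) by nra.
  assert (Hd1 : d < 1) by (apply Rmult_lt_reg_r with (2 * N * x); lra).
  assert (0 < d * x) by (apply Rmult_lt_0_compat; lra).
  pose proof (H (1 - d) ltac:(lra)) as H1.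
  pose proof (pow_ge_Bernoulli (1 - d) k ltac:(lra)) as H2.
  replace (INR k) with (N - 1) in H2 by (unfold N; ring).
  assert ((1 - (N - 1) * (1 - (1 - d))) * x <= (1 - d) ^ k * x) by now apply Rmult_le_compat_r.
  lra.
Qed.

(** Averaging [extremal_kernel_bound] with [e = z ^ S k / rho ^ S k] over the circle of radius
    [rho], the terms with positive powers of [z] drop out. There remains
    [2 |a|^2 + rho ^ S k * |d| <= 1 + |a|^2], where [c] rotates [d] to its modulus; then [rho] tends
    to 1. *)
Lemma Laurent_coefficient_bound (G : C -> C) (a d : C) (k : nat) :
  (forall z, 0 < Cmod z < 1 -> holo G z) ->
  (forall z, 0 < Cmod z < 1 -> Cmod (G z) <= 1) ->
  limit_at_0 G a -> disk_mean (fun z => G z / z ^ S k)%C d ->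
  Cmod d <= 1 - Cmod a ^ 2.
Proof.
  intros HG Hb Hl Hd.
  assert (Ha := limit_disk_mean G a HG Hl).
  assert (Hp := disk_mean_mult_pow G k HG Hb).
  assert (H1 : disk_mean (fun z => 1 * z ^ S k)%C 0).
  { apply (disk_mean_mult_pow (fun _ => 1) k).
    - intros z _. apply holo_const.
    - intros z _. rewrite Cmod_1. lra. }
  destruct (exists_rotation d) as (c & Hc & Hcd).
  apply le_of_pow_mult_le with (S k); [apply Cmod_ge_0|]. intros rho Hr.
  assert (HrK : 0 < rho ^ S k) by (apply pow_lt; lra).
  set (rK := rho ^ S k) in *.
  assert (HrC : RtoC rK <> 0) by (intros E; apply RtoC_inj in E; lra).
  assert (ML := circle_mean_plus rho _ _ _ _
    (circle_mean_scal rho _ (2 * Cconj a) _ (Ha rho Hr))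
    (circle_mean_plus rho _ _ _ _
      (circle_mean_scal rho _ (c * rK) _ (Hd rho Hr))
      (circle_mean_scal rho _ (Cconj a * Cconj a * Cconj c / rK) _ (Hp rho Hr)))).
  assert (MR := circle_mean_plus rho _ _ _ _
    (circle_mean_const rho (1 + a * Cconj a))
    (circle_mean_scal rho _ (2 * (Cconj a * Cconj c) / rK) _ (H1 rho Hr))).
  assert (Hle := circle_mean_le rho _ _ _ _ (proj1 Hr) ML MR).
  lapply Hle; clear Hle.
  - replace (2 * Cconj a * a + (c * rK * d + Cconj a * Cconj a * Cconj c / rK * 0))%C
      with (2 * (a * Cconj a) + rK * (c * d))%C by (field; easy).
    replace (1 + a * Cconj a + 2 * (Cconj a * Cconj c) / rK * 0)%C
      with (1 + a * Cconj a)%C by (field; easy).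
    rewrite Hcd, <- Cmod2_conj. unfold Re; simpl. lra.
  - intros z Hz. assert (Hz0 : z <> 0) by (apply Cmod_pos_neq_0; lra).
    assert (HzK : (z ^ S k)%C <> 0) by now apply Cpow_nz.
    set (e := (z ^ S k / rK)%C).
    assert (He : Cmod e = 1).
    { unfold e. rewrite Cmod_div, Cmod_pow, Hz, Cmod_R, Rabs_pos_eq by (easy || lra).
      fold rK. field. lra. }
    assert (Ee : Cconj e = (rK / z ^ S k)%C).
    { assert (E1 : (e * Cconj e = 1)%C) by (rewrite <- Cmod2_conj, He; f_equal; ring).
      transitivity (e * Cconj e * (rK / z ^ S k))%C.
      - unfold e at 2. field. now split.
      - rewrite E1. ring. }
    assert (HGz : Cmod (G z) <= 1) by (apply Hb; lra).
    pose proof (extremal_kernel_bound (G z) a c e HGz Hc He) as HB.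
    rewrite Ee in HB. unfold e in HB.
    eapply Rle_trans; [|eapply Rle_trans; [exact HB|]]; apply Req_le; f_equal;
      field; easy.
Qed.

(** Splitting off one factor [1 + g * z] turns the mean for [(S p, S m)] into the mean for
    [(p, S m)] plus [g] times the mean for [(p, m)]. The condition [p < m] keeps the exponent of [z]
    positive down to [p = 0], where [Laurent_coefficient_bound] applies. *)
Lemma Laurent_mean_bound (G : C -> C) (a : C) (g : R) (p : nat) :
  0 <= g ->
  (forall z, 0 < Cmod z < 1 -> holo G z) ->
  (forall z, 0 < Cmod z < 1 -> Cmod (G z) <= 1) ->
  limit_at_0 G a ->
  forall m, (p < m)%nat -> exists l,
    disk_mean (fun z => (1 + g * z) ^ p * (G z / z ^ m))%C l /\
    Cmod l <= (1 + g) ^ p * (1 - Cmod a ^ 2).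
Proof.
  intros Hg HG Hb Hl. induction p as [|p IH]; intros m Hm.
  - destruct m as [|k]; [lia|].
    destruct (holo_disk_mean (fun z => G z / z ^ S k)%C) as [d Hd].
    { intros z Hz. apply holo_mult; [now apply HG|]. apply holo_inv.
      - apply holo_pow, holo_id.
      - apply Cpow_nz, Cmod_pos_neq_0, Hz. }
    exists d. split.
    + eapply disk_mean_ext; [|reflexivity|exact Hd]. intros z _. simpl. ring.
    + pose proof (Laurent_coefficient_bound G a d k HG Hb Hl Hd). simpl. lra.
  - destruct m as [|m]; [lia|].
    destruct (IH (S m)) as (l1 & D1 & B1); [lia|].
    destruct (IH m) as (l2 & D2 & B2); [lia|].
    exists (l1 + g * l2)%C. split.
    + eapply disk_mean_ext; [|reflexivity|
        exact (disk_mean_plus _ _ _ _ D1 (disk_mean_scal _ g _ D2))].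
      intros z Hz. assert (Hz0 : z <> 0) by now apply Cmod_pos_neq_0.
      assert ((z ^ m)%C <> 0) by now apply Cpow_nz.
      rewrite !Cpow_S. field. now split.
    + eapply Rle_trans; [apply Cmod_triangle|].
      rewrite Cmod_mult, Cmod_R, Rabs_pos_eq by easy. simpl pow.
      pose proof (Rmult_le_compat_l g _ _ Hg B2). lra.
Qed.

(** * Power series near the origin *)

Lemma is_pseries_Cmod_le (b : nat -> C) (z l : C) (M : R) :
  is_pseries (K := C_AbsRing) (V := C_NormedModule) b z l ->
  (forall n, Cmod (b n) <= M * 2 ^ n) -> Cmod z <= 1 / 4 -> Cmod l <= 2 * M.
Proof.
  intros Hs Hb Hz.
  assert (HM : 0 <= M).
  { pose proof (Cmod_ge_0 (b 0%nat)). specialize (Hb 0%nat). simpl in Hb. lra. }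
  set (u := fun k => scal (pow_n (K := C_AbsRing) z k) (b k) : C_NormedModule).
  assert (Hu : forall n, norm (u n) <= M * (1 / 2) ^ n).
  { intros n. unfold u. change (Cmod (pow_n (K := C_AbsRing) z n * b n) <= M * (1 / 2) ^ n).
    replace (pow_n (K := C_AbsRing) z n) with (z ^ n)%C.
    2:{ induction n as [|n IH]; [easy|]. simpl. now rewrite IH. }
    rewrite Cmod_mult, Cmod_pow.
    replace (M * (1 / 2) ^ n) with ((1 / 4) ^ n * (M * 2 ^ n)).
    2:{ rewrite (Rmult_comm M), <- Rmult_assoc, <- Rpow_mult_distr, Rmult_comm.
        f_equal. f_equal. lra. }
    apply Rmult_le_compat; try apply Cmod_ge_0; [apply pow_le, Cmod_ge_0| |easy].
    apply pow_incr. split; [apply Cmod_ge_0 | easy]. }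
  (* The terms are at most [M * (1 / 2) ^ n]; the induction carries the exact geometric partial
     sum. *)
  assert (Hsum : forall n, norm (sum_n u n) <= M * (2 - (1 / 2) ^ n)).
  { induction n as [|n IH].
    - rewrite sum_O. specialize (Hu 0%nat). simpl in Hu |- *. lra.
    - rewrite sum_Sn. eapply Rle_trans; [apply norm_triangle|].
      specialize (Hu (S n)). simpl in Hu |- *. lra. }
  assert (Hlim : is_lim_seq (fun n => norm (sum_n u n)) (norm (l : C_NormedModule))).
  { apply filterlim_comp with (2 := filterlim_norm (l : C_NormedModule)). exact Hs. }
  assert (Hbd : forall n, norm (sum_n u n) <= 2 * M).
  { intros n. eapply Rle_trans; [apply Hsum|].
    assert (0 <= (1 / 2) ^ n) by (apply pow_le; lra). nra. }
  exact (is_lim_seq_le _ _ _ (2 * M) Hbd Hlim (is_lim_seq_const _)).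
Qed.

(** Partial sums of the series at [1 / 2] are eventually bounded, so their differences, the terms
    [b n / 2 ^ n], are bounded too. The finitely many earlier coefficients are covered by a
    maximum. *)
Lemma pseries_coefficients_bounded (b : nat -> C) (l : C) :
  is_pseries (K := C_AbsRing) (V := C_NormedModule) b (RtoC (1 / 2)) l ->
  exists M, forall n, Cmod (b n) <= M * 2 ^ n.
Proof.
  intros Hs.
  set (u := fun k => scal (pow_n (K := C_AbsRing) (RtoC (1 / 2)) k) (b k) : C_NormedModule).
  set (B := Cmod l + 1).
  assert (HB : 1 <= B) by (unfold B; pose proof (Cmod_ge_0 l); lra).
  assert (Hlim : is_lim_seq (fun n => norm (sum_n u n)) (norm (l : C_NormedModule))).
  { apply filterlim_comp with (2 := filterlim_norm (l : C_NormedModule)). exact Hs. }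
  apply is_lim_seq_spec in Hlim. destruct (Hlim (mkposreal 1 Rlt_0_1)) as [N HN].
  assert (HS : forall n, (N <= n)%nat -> norm (sum_n u n) <= B).
  { intros n Hn. specialize (HN n Hn). simpl in HN.
    pose proof (Rle_abs (norm (sum_n u n) - norm (l : C_NormedModule))) as Hr.
    unfold B. change (Cmod l) with (norm (l : C_NormedModule)). lra. }
  assert (Hterm : forall n, (S N <= n)%nat -> Cmod (b n) <= 2 * B * 2 ^ n).
  { intros n Hn.
    assert (Hu : norm (u n) <= 2 * B).
    { destruct n as [|n]; [lia|].
      replace (u (S n)) with (minus (sum_n u (S n)) (sum_n u n)).
      2:{ rewrite sum_Sn. unfold minus. rewrite plus_comm, plus_assoc, plus_opp_l.
          apply plus_zero_l. }
      eapply Rle_trans; [apply norm_triangle|]. rewrite norm_opp.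
      pose proof (HS (S n) ltac:(lia)). pose proof (HS n ltac:(lia)). lra. }
    change (Cmod (pow_n (K := C_AbsRing) (RtoC (1 / 2)) n * b n) <= 2 * B) in Hu.
    replace (pow_n (K := C_AbsRing) (RtoC (1 / 2)) n) with (RtoC (/ 2 ^ n)) in Hu.
    2:{ clear. induction n as [|n IH]; [simpl; now rewrite Rinv_1|].
        change (RtoC (/ 2 ^ S n) = RtoC (1 / 2) * pow_n (K := C_AbsRing) (RtoC (1 / 2)) n)%C.
        rewrite <- IH, <- RtoC_mult. f_equal. simpl. field. apply pow_nonzero. lra. }
    assert (0 < 2 ^ n) by (apply pow_lt; lra).
    rewrite Cmod_mult, Cmod_R, Rabs_pos_eq in Hu
      by (apply Rlt_le, Rinv_0_lt_compat; easy).
    apply Rmult_le_reg_l with (/ 2 ^ n); [now apply Rinv_0_lt_compat|].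
    replace (/ 2 ^ n * (2 * B * 2 ^ n)) with (2 * B) by (field; lra). lra. }
  assert (Hfin : forall k, exists M, 1 <= M /\ forall n, (n < k)%nat -> Cmod (b n) <= M * 2 ^ n).
  { induction k as [|k (M & HM & IH)]; [exists 1; split; [lra|lia]|].
    exists (Rmax M (Cmod (b k))).
    pose proof (Rmax_l M (Cmod (b k))). pose proof (Rmax_r M (Cmod (b k))).
    split; [lra|]. intros n Hn.
    assert (H2 : 1 <= 2 ^ n) by (apply pow_R1_Rle; lra).
    destruct (Nat.eq_dec n k) as [->|Hne].
    - apply Rle_trans with (Rmax M (Cmod (b k)) * 1); [lra|].
      apply Rmult_le_compat_l; lra.
    - apply Rle_trans with (M * 2 ^ n); [apply IH; lia|].
      apply Rmult_le_compat_r; lra. }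
  destruct (Hfin (S N)) as (M & HM & HMb). exists (M + 2 * B). intros n.
  assert (0 < 2 ^ n) by (apply pow_lt; lra).
  destruct (Nat.le_gt_cases (S N) n) as [Hn|Hn].
  - specialize (Hterm n Hn). nra.
  - specialize (HMb n Hn). nra.
Qed.

Lemma is_pseries_quotient (b : nat -> C) (z l : C) :
  z <> 0 -> is_pseries (K := C_AbsRing) (V := C_NormedModule) b z l ->
  is_pseries (K := C_AbsRing) (V := C_NormedModule) (fun n => b (S n)) z ((l - b 0%nat) * / z)%C.
Proof.
  intros Hz H.
  assert (E := is_pseries_decr_1 (K := C_AbsRing) (V := C_NormedModule) b z (/ z)%C l
    (Cinv_l z Hz) H).
  replace ((l - b 0%nat) * / z)%C with (/ z * (l - b 0%nat))%C by ring. exact E.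
Qed.

(** The quotient [(f z - b 0) / z] is the sum of the shifted series, bounded by [4 * M] for
    [Cmod z <= 1 / 4]; hence [f z - b 0] is [O(z)]. *)
Lemma pseries_limit_at_0 (f : C -> C) (b : nat -> C) :
  (forall z, 0 < Cmod z < 1 -> is_pseries (K := C_AbsRing) (V := C_NormedModule) b z (f z)) ->
  limit_at_0 f (b 0%nat).
Proof.
  intros H.
  destruct (pseries_coefficients_bounded b (f (RtoC (1 / 2)))) as [M HM].
  { apply H. rewrite Cmod_R, Rabs_pos_eq; lra. }
  assert (HM0 : 0 <= M).
  { pose proof (Cmod_ge_0 (b 0%nat)). specialize (HM 0%nat). simpl in HM. lra. }
  intros eps He.
  assert (Hd : 0 < eps / (4 * M + 1)) by (apply Rdiv_lt_0_compat; lra).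
  exists (Rmin (1 / 4) (eps / (4 * M + 1))). split; [apply Rmin_pos; lra|].
  intros z [Hz1 Hz2].
  assert (Hz3 := Rlt_le_trans _ _ _ Hz2 (Rmin_l _ _)).
  assert (Hz4 := Rlt_le_trans _ _ _ Hz2 (Rmin_r _ _)).
  assert (Hz : z <> 0) by now apply Cmod_pos_neq_0.
  assert (Hq := is_pseries_quotient b z (f z) Hz (H z ltac:(lra))).
  apply is_pseries_Cmod_le with (M := 2 * M) in Hq; [| |lra].
  2:{ intros n. specialize (HM (S n)). simpl in HM. lra. }
  rewrite Cmod_mult, Cmod_inv in Hq by easy.
  apply (Rmult_le_compat_r (Cmod z)) in Hq; [|lra].
  replace (Cmod (f z - b 0%nat) * / Cmod z * Cmod z) with (Cmod (f z - b 0%nat)) in Hq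
    by (field; lra).
  apply (Rmult_lt_compat_l (4 * M + 1)) in Hz4; [|lra].
  replace ((4 * M + 1) * (eps / (4 * M + 1))) with eps in Hz4 by (field; lra).
  nra.
Qed.

Lemma limit_at_0_mult (phi psi : C -> C) (a b : C) :
  limit_at_0 phi a -> limit_at_0 psi b -> limit_at_0 (fun z => phi z * psi z)%C (a * b)%C.
Proof.
  intros H1 H2 eps He.
  pose proof (Cmod_ge_0 a) as Ha. pose proof (Cmod_ge_0 b) as Hb.
  set (S := Cmod a + Cmod b + 1). assert (HS : 1 <= S) by (unfold S; lra).
  set (e := Rmin 1 (eps / S)).
  assert (HeS : 0 < eps / S) by (apply Rdiv_lt_0_compat; lra).
  assert (He' : 0 < e) by (apply Rmin_pos; lra).
  assert (He1 : e <= 1) by apply Rmin_l.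
  assert (He2 : e * S <= eps).
  { apply Rle_trans with (eps / S * S); [|apply Req_le; field; lra].
    apply Rmult_le_compat_r; [lra | apply Rmin_r]. }
  destruct (H1 e He') as (d1 & Hd1 & D1). destruct (H2 e He') as (d2 & Hd2 & D2).
  exists (Rmin d1 d2). split; [now apply Rmin_pos|]. intros z [Hz Hzd].
  specialize (D1 z (conj Hz (Rlt_le_trans _ _ _ Hzd (Rmin_l _ _)))).
  specialize (D2 z (conj Hz (Rlt_le_trans _ _ _ Hzd (Rmin_r _ _)))).
  replace (phi z * psi z - a * b)%C
    with ((phi z - a) * (psi z - b) + ((phi z - a) * b + a * (psi z - b)))%C by ring.
  eapply Rle_trans; [apply Cmod_triangle|].
  eapply Rle_trans; [apply Rplus_le_compat_l, Cmod_triangle|].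
  rewrite !Cmod_mult.
  pose proof (Cmod_ge_0 (phi z - a)). pose proof (Cmod_ge_0 (psi z - b)).
  assert (Cmod (phi z - a) * Cmod (psi z - b) <= e * 1) by (apply Rmult_le_compat; lra).
  assert (Cmod (phi z - a) * Cmod b <= e * Cmod b) by (apply Rmult_le_compat_r; lra).
  assert (Cmod a * Cmod (psi z - b) <= Cmod a * e) by (apply Rmult_le_compat_l; lra).
  unfold S in He2. lra.
Qed.

(** * The Moebius map and the coefficients of functions on [Omega] *)

Definition to_Omega (g : R) (w : C) : C := ((1 + g) * w / (1 + g * w))%C.

Lemma one_plus_Cmod_lower (g : R) (w : C) :
  0 <= g < 1 -> 1 - Cmod w <= Cmod (1 + g * w).
Proof.
  intros Hg. pose proof (Cmod_diff 1 (- (g * w))) as H.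
  rewrite Cmod_opp, Cmod_mult, Cmod_1, Cmod_R, Rabs_pos_eq in H by lra.
  replace (1 - - (g * w))%C with (1 + g * w)%C in H by ring.
  pose proof (Cmod_ge_0 w). nra.
Qed.

Lemma one_plus_neq_0 (g : R) (w : C) :
  0 <= g < 1 -> Cmod w < 1 -> (1 + g * w)%C <> 0.
Proof.
  intros Hg Hw. apply Cmod_pos_neq_0. pose proof (one_plus_Cmod_lower g w Hg). lra.
Qed.

Lemma to_Omega_neq_0 (g : R) (w : C) :
  0 <= g < 1 -> 0 < Cmod w < 1 -> to_Omega g w <> 0.
Proof.
  intros Hg Hw. unfold to_Omega, Cdiv. repeat apply Cmult_neq_0.
  - rewrite <- RtoC_plus. intros E. apply RtoC_inj in E. lra.
  - now apply Cmod_pos_neq_0.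
  -
    assert (H := one_plus_neq_0 g w Hg (proj2 Hw)).
    intros E. apply C1_nz. rewrite <- (Cinv_l _ H), E. ring.
Qed.

(** Relative to the centre of [Omega g], the image point is [(w + g) / (1 + g * w)], a disk
    automorphism, divided by [1 - g]. *)
Lemma to_Omega_in (g : R) (w : C) :
  0 <= g < 1 -> Cmod w < 1 -> Omega g (to_Omega g w).
Proof.
  intros Hg Hw. assert (H1 := one_plus_neq_0 g w Hg Hw).
  assert (Hg1 : RtoC (1 - g) <> 0) by (intros E; apply RtoC_inj in E; lra).
  unfold Omega, to_Omega.
  replace ((1 + g) * w / (1 + g * w) + RtoC (g / (1 - g)))%C
    with ((w + g) / (RtoC (1 - g) * (1 + g * w)))%C.
  2:{ rewrite RtoC_div, RtoC_minus in * by lra. field. now split. }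
  rewrite Cmod_div, Cmod_mult, Cmod_R, Rabs_pos_eq by (lra || now apply Cmult_neq_0).
  assert (HP : 0 < Cmod (1 + g * w)).
  { pose proof (one_plus_Cmod_lower g w Hg). lra. }
  (* This follows from [|1 + g w|^2 - |w + g|^2 = (1 - g^2) (1 - |w|^2)]. *)
  assert (Hlt : Cmod (w + g) < Cmod (1 + g * w)).
  { apply Rsqr_incrst_0; try apply Cmod_ge_0. unfold Rsqr.
    assert (E : forall z, Cmod z * Cmod z = Re z ^ 2 + Im z ^ 2).
    { intros z. rewrite <- Cmod2_alt. ring. }
    rewrite !E.
    assert (Hw2 : Re w ^ 2 + Im w ^ 2 < 1).
    { rewrite <- Cmod2_alt. pose proof (Cmod_ge_0 w). nra. }
    assert (0 < (1 - g ^ 2) * (1 - (Re w ^ 2 + Im w ^ 2)))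
      by (apply Rmult_lt_0_compat; nra).
    destruct w as [x y]. unfold Re, Im in *; simpl in *. lra. }
  apply Rmult_lt_reg_r with ((1 - g) * Cmod (1 + g * w)).
  - apply Rmult_lt_0_compat; lra.
  - replace (Cmod (w + g) / ((1 - g) * Cmod (1 + g * w)) * ((1 - g) * Cmod (1 + g * w)))
      with (Cmod (w + g)) by (field; lra).
    replace (1 / (1 - g) * ((1 - g) * Cmod (1 + g * w))) with (Cmod (1 + g * w)) by (field; lra).
    easy.
Qed.

Lemma holo_one_plus (g : R) (w : C) : holo (fun w => 1 + g * w)%C w.
Proof.
  apply holo_plus; [apply holo_const|]. apply holo_mult; [apply holo_const | apply holo_id].
Qed.

Lemma holo_to_Omega (g : R) (w : C) :
  0 <= g < 1 -> Cmod w < 1 -> holo (to_Omega g) w.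
Proof.
  intros Hg Hw. unfold to_Omega, Cdiv.
  apply (holo_mult (fun w => (1 + g) * w)%C (fun w => / (1 + g * w))%C).
  - apply holo_mult; [apply holo_const | apply holo_id].
  - apply holo_inv; [apply holo_one_plus | now apply one_plus_neq_0].
Qed.

Lemma limit_at_0_comp_to_Omega (g : R) (f : C -> C) (a : C) :
  0 <= g < 1 -> limit_at_0 f a -> limit_at_0 (fun w => f (to_Omega g w)) a.
Proof.
  intros Hg H eps He. destruct (H eps He) as (d & Hd & D).
  (* For [Cmod w < 1 / 2] the denominator exceeds [1 / 2] and the factor [1 + g] is below 2, so the
     image has modulus less than [4 * Cmod w]. *)
  exists (Rmin (1 / 2) (d / 4)). split; [apply Rmin_pos; lra|]. intros w [Hw0 Hw].
  assert (Hw1 := Rlt_le_trans _ _ _ Hw (Rmin_l _ _)).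
  assert (Hw2 := Rlt_le_trans _ _ _ Hw (Rmin_r _ _)).
  pose proof (one_plus_Cmod_lower g w Hg) as HL.
  apply D. split.
  - apply (proj1 (Cmod_gt_0 _)), to_Omega_neq_0; lra.
  - unfold to_Omega. rewrite Cmod_div, Cmod_mult, <- RtoC_plus, Cmod_R, Rabs_pos_eq
      by (lra || apply one_plus_neq_0; lra).
    apply Rlt_div_l; [lra|]. nra.
Qed.

Lemma limit_at_0_inv_one_plus (g : R) :
  0 <= g < 1 -> limit_at_0 (fun w => / (1 + g * w))%C 1.
Proof.
  intros Hg eps He. exists (Rmin (1 / 2) (eps / 2)). split; [apply Rmin_pos; lra|].
  intros w [Hw0 Hw].
  assert (Hw1 := Rlt_le_trans _ _ _ Hw (Rmin_l _ _)).
  assert (Hw2 := Rlt_le_trans _ _ _ Hw (Rmin_r _ _)).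
  pose proof (one_plus_Cmod_lower g w Hg) as HL.
  assert (Hn : (1 + g * w)%C <> 0) by (apply one_plus_neq_0; lra).
  replace (/ (1 + g * w) - 1)%C with (- (g * w) / (1 + g * w))%C by (field; easy).
  rewrite Cmod_div, Cmod_opp, Cmod_mult, Cmod_R, Rabs_pos_eq by (easy || lra).
  apply Rle_div_l; [lra|]. nra.
Qed.

(** For the constant function 1 the factor [1 - Cmod a ^ 2] in [Laurent_mean_bound] is 0, so the
    bound forces the mean to vanish. *)
Lemma mean_inverse_pow_one_plus (g : R) (n : nat) :
  0 <= g -> disk_mean (fun w => (1 + g * w) ^ n / w ^ S n)%C 0.
Proof.
  intros Hg.
  destruct (Laurent_mean_bound (fun _ => 1) 1 g n Hg) with (m := S n) as (l & Hl & Hb).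
  - intros z _. apply holo_const.
  - intros z _. rewrite Cmod_1. lra.
  - intros eps He. exists 1. split; [lra|]. intros z _.
    replace (1 - 1)%C with (RtoC 0) by ring. rewrite Cmod_0. lra.
  - lia.
  - rewrite Cmod_1 in Hb. pose proof (Cmod_ge_0 l).
    eapply disk_mean_ext; [| |exact Hl].
    + intros z _. cbv beta. unfold Cdiv. ring.
    + apply Cmod_eq_0. simpl in Hb. rewrite !Rmult_1_r, Rminus_diag, Rmult_0_r in Hb. lra.
Qed.

(* Cauchy's coefficient formula, transported to the unit disk by [z = to_Omega g w]: there
   [dz / z = dw / (w (1 + g w))]. *)
Lemma coefficient_mean (g : R) (n : nat) : 0 <= g < 1 -> forall (f : C -> C) (a : nat -> C),
  (forall z, Omega g z -> z <> 0 -> holo f z) ->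
  (forall z, 0 < Cmod z < 1 -> is_pseries (K := C_AbsRing) (V := C_NormedModule) a z (f z)) ->
  disk_mean (fun w => f (to_Omega g w) * / (1 + g * w) * ((1 + g * w) ^ n / w ^ n))%C
    ((1 + g) ^ n * a n)%C.
Proof.
  intros Hg. induction n as [|n IH]; intros f a Hf Ha.
  - apply (disk_mean_ext (fun w => f (to_Omega g w) * / (1 + g * w))%C _ (a 0%nat * 1)%C).
    + intros z Hz. simpl. field. now apply one_plus_neq_0.
    + simpl. ring.
    + apply limit_disk_mean.
      * intros w Hw. apply holo_mult.
        -- apply holo_comp; [|now apply holo_to_Omega].
           apply Hf; [now apply to_Omega_in | now apply to_Omega_neq_0].
        -- apply holo_inv; [apply holo_one_plus | now apply one_plus_neq_0].
      * apply limit_at_0_mult; [|now apply limit_at_0_inv_one_plus].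
        apply limit_at_0_comp_to_Omega; [easy|]. now apply pseries_limit_at_0.
  - assert (H1 := IH (fun z => (f z - a 0%nat) * / z)%C (fun n => a (S n))).
    lapply H1; clear H1; [intros H1|].
    + lapply H1; clear H1; [intros H1|].
      (* Substituting [f = a 0 + z F] with [z = to_Omega g w], the integrand becomes
         [a 0 * (1 + g w)^n / w^(n+1)], of mean 0, plus [1 + g] times the integrand of [F] at
         [n]. *)
      * eapply disk_mean_ext; [| |exact (disk_mean_plus _ _ _ _
          (disk_mean_scal _ (a 0%nat) _ (mean_inverse_pow_one_plus g n (proj1 Hg)))
          (disk_mean_scal _ (1 + g)%C _ H1))].
        -- intros w Hw. cbv beta.
           assert (Hz := to_Omega_neq_0 g w Hg Hw).
           assert (Hw0 : w <> 0) by now apply Cmod_pos_neq_0.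
           assert (Hp := one_plus_neq_0 g w Hg (proj2 Hw)).
           assert ((w ^ n)%C <> 0) by now apply Cpow_nz.
           assert (Hg1 : (1 + g)%C <> 0).
           { rewrite <- RtoC_plus. intros E. apply RtoC_inj in E. lra. }
           set (F := f (to_Omega g w)). unfold to_Omega. rewrite !Cpow_S. field.
           repeat split; assumption.
        -- rewrite Cpow_S. ring.
      * intros z Hz. apply is_pseries_quotient; [now apply Cmod_pos_neq_0 | now apply Ha].
    + intros z Hz Hz0. apply holo_mult.
      * apply holo_plus; [now apply Hf | apply holo_const].
      * apply holo_inv; [apply holo_id | easy].
Qed.

Lemma Omega_coefficient_bound (g : R) (f : C -> C) (a : nat -> C) (n : nat) :
  0 <= g < 1 ->
  (forall z, Omega g z -> holo f z) ->
  (forall z, 0 < Cmod z < 1 -> is_pseries (K := C_AbsRing) (V := C_NormedModule) a z (f z)) ->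
  (forall z, Omega g z -> Cmod (f z) <= 1) ->
  (1 + g) * Cmod (a (S n)) <= 1 - Cmod (a 0%nat) ^ 2.
Proof.
  intros Hg Hf Ha Hb.
  destruct (Laurent_mean_bound (fun w => f (to_Omega g w)) (a 0%nat) g n (proj1 Hg))
    with (m := S n) as (l & Hl & Hle).
  - intros w Hw. apply holo_comp; [apply Hf, to_Omega_in | apply holo_to_Omega]; easy.
  - intros w Hw. apply Hb, to_Omega_in; easy.
  - apply limit_at_0_comp_to_Omega; [easy|]. now apply pseries_limit_at_0.
  - lia.
  (* The factor [/ (1 + g * w)] of [coefficient_mean] lowers the exponent [S n] to [n], so both
     means have the same integrand; one power of [1 + g] is thereby gained. *)
  - assert (E : l = ((1 + g) ^ S n * a (S n))%C).
    { eapply disk_mean_unique; [|apply (coefficient_mean g (S n) Hg f a); auto].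
      eapply disk_mean_ext; [|reflexivity|exact Hl]. intros w Hw. cbv beta.
      assert (Hp := one_plus_neq_0 g w Hg (proj2 Hw)).
      rewrite (Cpow_S (1 + g * w)). field. split; [|easy].
      apply Cpow_nz, Cmod_pos_neq_0, Hw. }
    rewrite E, Cmod_mult, Cmod_pow, <- RtoC_plus, Cmod_R, Rabs_pos_eq in Hle by lra.
    assert (0 < (1 + g) ^ n) by (apply pow_lt; lra).
    apply Rmult_le_reg_l with ((1 + g) ^ n); [easy|]. simpl pow in Hle |- *. lra.
Qed.

(** * Coefficients of the pair [(h, g)] *)

Lemma ex_derive_holo (f : C -> C) (z : C) :
  ex_derive (K := C_AbsRing) (V := C_NormedModule) f z -> holo f z.
Proof.
  intros H. destruct (ex_derive_expansion f z H) as [l Hl].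
  now apply expansion_holo with l.
Qed.

Lemma Cmod_plus_orthogonal (x y : C) :
  Re (Cconj x * y) = 0 -> Cmod (x + y) ^ 2 = Cmod x ^ 2 + Cmod y ^ 2.
Proof. rewrite !Cmod2_alt. destruct x, y; unfold Re, Im; simpl. intros H. lra. Qed.

Lemma Cmod_parallelogram (x y : C) :
  Cmod (x + y) ^ 2 + Cmod (x + - y) ^ 2 = 2 * (Cmod x ^ 2 + Cmod y ^ 2).
Proof. rewrite !Cmod2_alt. destruct x, y; unfold Re, Im; simpl. ring. Qed.

(** The function [h + eps g] is bounded by [|h| + |g| <= 1], and orthogonality turns the squared
    modulus of its constant term into the sum of squares. *)
Lemma pair_coefficient_bound_rotated (gamma : R) (h g : C -> C) (a b : nat -> C)
  (eps : C) (n : nat) :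
  0 <= gamma < 1 ->
  analytic_on (Omega gamma) h -> analytic_on (Omega gamma) g ->
  (forall z, unit_disk z -> is_pseries (K := C_AbsRing) (V := C_NormedModule) a z (h z)) ->
  (forall z, unit_disk z -> is_pseries (K := C_AbsRing) (V := C_NormedModule) b z (g z)) ->
  (forall z, Omega gamma z -> Cmod (h z) + Cmod (g z) <= 1) ->
  Cmod eps = 1 -> Re (Cconj (a 0%nat) * (eps * b 0%nat)) = 0 ->
  (1 + gamma) * Cmod (a (S n) + eps * b (S n))
    <= 1 - (Cmod (a 0%nat) ^ 2 + Cmod (b 0%nat) ^ 2).
Proof.
  intros Hg Hh Hgg Ha Hb Hle He Ho.
  assert (E : Cmod (a 0%nat + eps * b 0%nat) ^ 2 = Cmod (a 0%nat) ^ 2 + Cmod (b 0%nat) ^ 2).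
  { rewrite (Cmod_plus_orthogonal _ _ Ho), Cmod_mult, He. ring. }
  rewrite <- E.
  apply (Omega_coefficient_bound gamma (fun z => h z + eps * g z)%C
    (fun n => a n + eps * b n)%C n Hg).
  - intros z Hz. apply holo_plus; [apply ex_derive_holo; now apply Hh|].
    apply holo_mult; [apply holo_const | apply ex_derive_holo; now apply Hgg].
  - intros z [_ Hz].
    apply (is_pseries_plus (K := C_AbsRing) (V := C_NormedModule)); [now apply Ha|].
    apply (is_pseries_scal (K := C_AbsRing) (V := C_NormedModule)).
    + apply Cmult_comm.
    + now apply Hb.
  - intros z Hz. eapply Rle_trans; [apply Cmod_triangle|].
    rewrite Cmod_mult, He, Rmult_1_l. now apply Hle.
Qed.

(* Rotating [b] so that [a 0] and [eps * b 0] are orthogonal makes the bounds for [h + eps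
   g] and [h - eps g] agree, and the parallelogram law combines them without loss. *)
Lemma pair_coefficient_bound (gamma : R) (h g : C -> C) (a b : nat -> C) (n : nat) :
  0 <= gamma < 1 ->
  analytic_on (Omega gamma) h -> analytic_on (Omega gamma) g ->
  (forall z, unit_disk z -> is_pseries (K := C_AbsRing) (V := C_NormedModule) a z (h z)) ->
  (forall z, unit_disk z -> is_pseries (K := C_AbsRing) (V := C_NormedModule) b z (g z)) ->
  (forall z, Omega gamma z -> Cmod (h z) + Cmod (g z) <= 1) ->
  (1 + gamma) * sqrt (Cmod (a (S n)) ^ 2 + Cmod (b (S n)) ^ 2)
    <= 1 - (Cmod (a 0%nat) ^ 2 + Cmod (b 0%nat) ^ 2).
Proof.
  intros Hg Hh Hgg Ha Hb Hle.
  destruct (exists_rotation (Cconj (a 0%nat) * b 0%nat)) as (c & Hc & Hcd).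
  (* The rotation [c] makes [conj (a 0) * b 0] real, and the factor [Ci] makes it purely
     imaginary. *)
  set (eps := (Ci * c)%C).
  assert (He : Cmod eps = 1) by (unfold eps; rewrite Cmod_mult, Cmod_Ci, Hc; ring).
  assert (Ho : Re (Cconj (a 0%nat) * (eps * b 0%nat)) = 0).
  { replace (Cconj (a 0%nat) * (eps * b 0%nat))%C
      with (Ci * (c * (Cconj (a 0%nat) * b 0%nat)))%C by (unfold eps; ring).
    rewrite Hcd. unfold Re; simpl. ring. }
  assert (B1 := pair_coefficient_bound_rotated gamma h g a b eps n Hg Hh Hgg Ha Hb Hle He Ho).
  assert (B2 := pair_coefficient_bound_rotated gamma h g a b (- eps) n Hg Hh Hgg Ha Hb Hle).
  rewrite Cmod_opp in B2.
  assert (Ho' : Re (Cconj (a 0%nat) * (- eps * b 0%nat)) = 0).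
  { replace (Cconj (a 0%nat) * (- eps * b 0%nat))%C
      with (- (Cconj (a 0%nat) * (eps * b 0%nat)))%C by ring.
    change (- Re (Cconj (a 0%nat) * (eps * b 0%nat)) = 0). rewrite Ho. ring. }
  specialize (B2 He Ho').
  replace (- eps * b (S n))%C with (- (eps * b (S n)))%C in B2 by ring.
  assert (HP := Cmod_parallelogram (a (S n)) (eps * b (S n))).
  rewrite (Cmod_mult eps), He, Rmult_1_l in HP.
  set (K := 1 - (Cmod (a 0%nat) ^ 2 + Cmod (b 0%nat) ^ 2)) in *.
  set (p := Cmod (a (S n) + eps * b (S n))) in *.
  set (q := Cmod (a (S n) + - (eps * b (S n)))) in *.
  assert (Hp : 0 <= (1 + gamma) * p) by (apply Rmult_le_pos; [lra | apply Cmod_ge_0]).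
  assert (Hq : 0 <= (1 + gamma) * q) by (apply Rmult_le_pos; [lra | apply Cmod_ge_0]).
  set (s := Cmod (a (S n)) ^ 2 + Cmod (b (S n)) ^ 2) in *.
  assert (Hs : 0 <= s) by (pose proof (pow2_ge_0 p); pose proof (pow2_ge_0 q); lra).
  (* Adding the squares of both bounds gives [(1 + gamma)^2 * 2 s <= 2 K^2]; nonnegativity of [K]
     follows from [Hp] and [B1]. *)
  assert (S1 := pow_incr _ _ 2 (conj Hp B1)). assert (S2 := pow_incr _ _ 2 (conj Hq B2)).
  apply Rsqr_incr_0_var; [|lra].
  rewrite Rsqr_mult, Rsqr_sqrt by easy. unfold Rsqr.
  assert (E : (1 + gamma) ^ 2 * (p ^ 2 + q ^ 2) = (1 + gamma) ^ 2 * (2 * s)) by now rewrite HP.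
  lra.
Qed.

(** * Summation of the majorant series *)

(** The tail is dominated by a geometric series with ratio [r]. For [k = 1 + gamma] the threshold
    [k / (2 + k)] is [r_0], and [r <= k / (2 + k)] is equivalent to [r / (1 - r) <= k / 2]. *)
Lemma Bohr_sum_bound (c : nat -> R) (k r : R) :
  (forall n, 0 <= c n) -> 0 < k -> 0 <= r <= k / (2 + k) ->
  (forall n, k * c (S n) <= 1 - c 0%nat ^ 2) ->
  ex_series (fun n => c n * r ^ n) /\
  c 0%nat + Series (fun n => c (S n) * r ^ S n) <= 1.
Proof.
  intros Hc Hk [Hr0 Hr] Hb.
  assert (Hrk : r * (2 + k) <= k).
  { apply (Rmult_le_compat_r (2 + k)) in Hr; [|lra].
    now replace (k / (2 + k) * (2 + k)) with k in Hr by (field; lra). }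
  assert (Hr1 : r < 1) by nra.
  set (K := (1 - c 0%nat ^ 2) / k).
  assert (HK : k * K = 1 - c 0%nat ^ 2) by (unfold K; field; lra).
  assert (HcK : forall n, c (S n) <= K).
  { intros n. apply Rmult_le_reg_l with k; [easy|]. rewrite HK. apply Hb. }
  assert (HK0 : 0 <= K) by (eapply Rle_trans; [apply (Hc 1%nat) | apply HcK]).
  assert (Hgeom : is_series (fun n => K * r * r ^ n) (K * r * / (1 - r))).
  { apply (is_series_scal (V := R_NormedModule) (K * r)). apply is_series_geom.
    rewrite Rabs_pos_eq; lra. }
  assert (Hterm : forall n, 0 <= c (S n) * r ^ S n <= K * r * r ^ n).
  { intros n. assert (0 <= r ^ S n) by (apply pow_le; lra). split.
    - now apply Rmult_le_pos.
    - replace (K * r * r ^ n) with (K * r ^ S n) by (simpl; ring).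
      now apply Rmult_le_compat_r. }
  assert (Hex : ex_series (fun n => c (S n) * r ^ S n)).
  { apply (ex_series_le (V := R_CompleteNormedModule)) with (fun n => K * r * r ^ n).
    - intros n. change (Rabs (c (S n) * r ^ S n) <= K * r * r ^ n).
      rewrite Rabs_pos_eq; apply Hterm.
    - eexists; exact Hgeom. }
  split.
  - apply (ex_series_incr_1 (fun n => c n * r ^ n)). exact Hex.
  - assert (HS : Series (fun n => c (S n) * r ^ S n) <= K * r * / (1 - r)).
    { rewrite <- (is_series_unique _ _ Hgeom). apply Series_le; [exact Hterm|].
      eexists; exact Hgeom. }
    assert (HR : K * r * / (1 - r) <= K * k / 2).
    { apply Rmult_le_reg_r with (1 - r); [lra|].
      replace (K * r * / (1 - r) * (1 - r)) with (K * r) by (field; lra).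
      assert (0 <= K * (k - r * (2 + k))) by (apply Rmult_le_pos; lra). lra. }
    (* Since [K * k / 2 = (1 - c 0 ^ 2) / 2], the sum is at most [c 0 + (1 - c 0 ^ 2) / 2 = 1 - (1 -
       c 0) ^ 2 / 2]. *)
    assert (0 <= (1 - c 0%nat) ^ 2) by apply pow2_ge_0. lra.
Qed.

Theorem theorem2p7 (gamma : R) (h g : C -> C) (a b : nat -> C) :
  0 <= gamma < 1 ->
  analytic_on (Omega gamma) h ->
  analytic_on (Omega gamma) g ->
  (forall z, unit_disk z -> is_pseries (K := C_AbsRing) (V := C_NormedModule) a z (h z)) ->
  (forall z, unit_disk z -> is_pseries (K := C_AbsRing) (V := C_NormedModule) b z (g z)) ->
  (forall z, Omega gamma z -> Cmod (h z) + Cmod (g z) <= 1) ->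
  forall r : R, 0 <= r <= (1 + gamma) / (3 + gamma) ->
    ex_series (fun n => sqrt (Cmod (a n) ^ 2 + Cmod (b n) ^ 2) * r ^ n) /\
    sqrt (Cmod (a 0%nat) ^ 2 + Cmod (b 0%nat) ^ 2)
    + Series (fun n => sqrt (Cmod (a (S n)) ^ 2 + Cmod (b (S n)) ^ 2) * r ^ (S n)) <= 1.

Proof.
  intros Hg Hh Hgg Ha Hb Hle r Hr.
  apply (Bohr_sum_bound (fun n => sqrt (Cmod (a n) ^ 2 + Cmod (b n) ^ 2)) (1 + gamma)).
  - intros n. apply sqrt_pos.
  - lra.
  - now replace (2 + (1 + gamma)) with (3 + gamma) by ring.
  - intros n. rewrite pow2_sqrt by (apply Rplus_le_le_0_compat; apply pow2_ge_0).
    exact (pair_coefficient_bound gamma h g a b n Hg Hh Hgg Ha Hb Hle).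
Qed.
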